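(* Let $\delta\ge 0$. For any morphism $f:M\to N$ of p.f.d. persistence modules, the induced matching $\mathcal X(f):\mathcal B(M)\to\mathcal B(N)$ is a morphism in $\mathbf{Barc}$ such that (i) if $f$ has $\delta$-trivial kernel, then so does $\mathcal X(f)$, and (ii) if $f$ has $\delta$-trivial cokernel, then so does $\mathcal X(f)$.
   Context: Fix a field $K$. $\mathbf{vect}$ is the category of finite dimensional $K$-vector spaces, $\mathbf R$ the poset category of real numbers. A pointwise finite dimensional (p.f.d.) persistence module is an object of the functor category $\mathbf{vect}^{\mathbf R}$. An interval is a non-empty set $I\subseteq\mathbb R$ such that $a,c\in I$ and $a<b<c$ imply $b\in I$. A barcode is a multiset representation of intervals: a subset of $S\times X$ where $S$ is a set of intervals and $X$ is any set (of indices). An element $(I,x)$ is usually written simply $I$. A barcode is natural if $X=\mathbb N=\{1,2,\dots\}$ and for each $I$ the set of its indices is a prefix of $\mathbb N$. For a p.f.d. persistence module $M$, $\mathcal B(M)$ denotes the unique natural barcode with $M\cong\bigoplus_{I\in\mathcal B(M)}K^I$ (it exists by the structure theorem), where the interval module $K^I$ is $K$ at indices in $I$, $0$ elsewhere, with identity internal maps between indices in $I$. For intervals $I,J$: $I$ bounds $J$ above if for all $s\in J$ there is $t\in I$ with $s\le t$; $I$ and $J$ coincide above if each bounds the other above. $J$ bounds $I$ below if for all $t\in I$ there is $s\in J$ with $s\le t$; $I$ and $J$ coincide below if each bounds the other below. $I$ overlaps $J$ above if $I\cap J\neq\emptyset$, $I$ bounds $J$ above, and $J$ bounds $I$ below.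 An overlap matching $\sigma:\mathcal C\to\mathcal D$ of barcodes is a matching (partial injective function) such that $\sigma(I)=J$ implies that $I$ overlaps $J$ above. $\mathbf{Barc}$ is the category of barcodes and overlap matchings with composition $\tau\bullet\sigma=\{(I,K)\in\tau\circ\sigma\mid I\text{ overlaps }K\text{ above}\}$, where $\tau\circ\sigma$ is composition of relations. The empty barcode is the zero object of $\mathbf{Barc}$; kernels and cokernels in $\mathbf{Barc}$ are the categorical ones (they exist). Induced matching of a monomorphism $f:M\hookrightarrow N$: coinciding above is an equivalence relation on intervals. For a class $e$, let $\mathcal B(M)^e$ be the set of elements of $\mathcal B(M)$ whose interval lies in $e$, totally ordered by $(I,n)<(J,n')$ if $I\supsetneq J$, or $I=J$ and $n<n'$; this is isomorphic to a prefix of $\mathbb N$. $\mathcal X(f)$ sends, for each $e$, the $i$th element of $\mathcal B(M)^e$ to the $i$th element of $\mathcal B(N)^e$ (it is a fact that $|\mathcal B(M)^e|\le|\mathcal B(N)^e|$). Induced matching of an epimorphism $f:M\twoheadrightarrow N$: dually, with $e$ ranging over classes of intervals under coinciding below and the same total orders; here $|\mathcal B(N)^e|\le|\mathcal B(M)^e|$ and $\mathcal X(f)$ matches, for each $e$ and $i\le|\mathcal B(N)^e|$, the $i$th element of $\mathcal B(M)^e$ with the $i$th element of $\mathcal B(N)^e$. For an arbitrary morphism $f$ with epi-mono factorization $M\stackrel{q}{\twoheadrightarrow}\operatorname{im}f\stackrel{i}{\hookrightarrow}N$, the induced matching is the composite $\mathcal X(f)=\mathcal X(i)\circ\mathcal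 X(q)$. $\delta$-triviality: for a category $\mathbf A$ with zero object, a functor $M:\mathbf R\to\mathbf A$ is $\delta$-trivial if for all $t\in\mathbb R$ the internal morphism $M_{t,t+\delta}:M_t\to M_{t+\delta}$ is a zero morphism. Let $\mathbf{Mch}$ be the category of sets and matchings (zero object: the empty set). A barcode $\mathcal C$ is $\delta$-trivial if the functor $E(\mathcal C):\mathbf R\to\mathbf{Mch}$ with $E(\mathcal C)_t=\{I\in\mathcal C\mid t\in I\}$ and $E(\mathcal C)_{s,t}=\{(I,I)\mid I\in\mathcal C,\ s,t\in I\}$ is $\delta$-trivial; equivalently, each interval of $\mathcal C$ is contained in some half-open interval of length $\delta$. *)

(* Defs.v *)
From HB Require Import structures.
From mathcomp Require Import all_boot all_order all_algebra.
From mathcomp Require Import boolp classical_sets functions cardinality fsbigop.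
From mathcomp Require Import reals.

Set Implicit Arguments.
Unset Strict Implicit.
Unset Printing Implicit Defensive.

Import Order.TTheory GRing.Theory Num.Theory.
Local Open Scope classical_set_scope.
Local Open Scope card_scope.
Local Open Scope ring_scope.

(** * Categories, zero morphisms, kernels and cokernels *)

Record category := Category {
  Ob :> Type;
  Mor : Ob -> Ob -> Type;
  idm : forall A, Mor A A;
  ccomp : forall A B C, Mor B C -> Mor A B -> Mor A C;
  ccomp1r : forall A B (f : Mor A B), ccomp f (idm A) = f;
  ccomp1l : forall A B (f : Mor A B), ccomp (idm B) f = f;
  ccompA : forall A B C D (h : Mor C D) (g : Mor B C) (f : Mor A B),
    ccomp h (ccomp g f) = ccomp (ccomp h g) f }.

Section CategoryNotions.
Variable A : category.

Definition zero_object (Z : A) : Prop :=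
  (forall X : A, exists f : Mor X Z, forall g, g = f) /\
  (forall X : A, exists f : Mor Z X, forall g, g = f).

Definition zero_morphism (X Y : A) (f : Mor X Y) : Prop :=
  exists (Z : A) (g : Mor X Z) (h : Mor Z Y), zero_object Z /\ f = ccomp h g.

Definition is_kernel (X Y : A) (f : Mor X Y) (L : A) (k : Mor L X) : Prop :=
  zero_morphism (ccomp f k) /\
  forall (T : A) (g : Mor T X), zero_morphism (ccomp f g) ->
    exists! h : Mor T L, ccomp k h = g.

Definition is_cokernel (X Y : A) (f : Mor X Y) (C : A) (c : Mor Y C) : Prop :=
  zero_morphism (ccomp c f) /\
  forall (T : A) (g : Mor Y T), zero_morphism (ccomp g f) ->
    exists! h : Mor C T, ccomp h c = g.

(* Kernels and cokernels are unique up to isomorphism, so for an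
   isomorphism-invariant [P] it is immaterial which one is taken. *)
Definition has_kernel_with (P : A -> Prop) (X Y : A) (f : Mor X Y) : Prop :=
  exists (L : A) (k : Mor L X), is_kernel f k /\ P L.

Definition has_cokernel_with (P : A -> Prop) (X Y : A) (f : Mor X Y) : Prop :=
  exists (C : A) (c : Mor Y C), is_cokernel f c /\ P C.

End CategoryNotions.

(** * Functors from the poset category of the reals *)

Section RFunctor.
Variables (R : realType) (A : category).

Record Rfunctor := RFunctor {
  fob :> R -> A;
  fmap : forall s t, s <= t -> Mor (fob s) (fob t);
  fmap_id : forall t (h : t <= t), fmap h = idm (fob t);
  fmap_comp : forall s t u (h1 : s <= t) (h2 : t <= u) (h3 : s <= u),
    fmap h3 = ccomp (fmap h2) (fmap h1) }.

Record nattrans (M N : Rfunctor) := NatTrans {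
  ntmap :> forall t, Mor (M t) (N t);
  ntmapP : forall s t (h : s <= t),
    ccomp (ntmap t) (fmap M h) = ccomp (fmap N h) (ntmap s) }.

Lemma nattrans_eq (M N : Rfunctor) (f g : nattrans M N) :
  (forall t, f t = g t) -> f = g.
Proof.
case: f g => [f fP] [g gP] /= fg.
have e : f = g by apply: functional_extensionality_dep.
by subst g; congr NatTrans; apply: Prop_irrelevance.
Qed.

Definition nattrans_id (M : Rfunctor) : nattrans M M.
Proof. by exists (fun t => idm (M t)) => s t h; rewrite ccomp1l ccomp1r. Defined.

Definition nattrans_comp (M N P : Rfunctor)
  (g : nattrans N P) (f : nattrans M N) : nattrans M P.
Proof.
exists (fun t => ccomp (g t) (f t)) => s t h.
by rewrite -ccompA ntmapP ccompA ntmapP ccompA.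
Defined.

Definition Rfun_category : category.
Proof.
refine (@Category Rfunctor nattrans nattrans_id nattrans_comp _ _ _).
- by move=> M N f; apply: nattrans_eq => t; exact: ccomp1r.
- by move=> M N f; apply: nattrans_eq => t; exact: ccomp1l.
- by move=> M N P Q h g f; apply: nattrans_eq => t; exact: ccompA.
Defined.

Definition delta_trivial (delta : R) (M : Rfunctor) : Prop :=
  forall t (h : t <= t + delta), zero_morphism (fmap M h).

End RFunctor.

(** * Pointwise finite dimensional persistence modules *)

Definition vect (K : fieldType) : category.
Proof.
refine (@Category (vectType K) (fun U V => 'Hom(U, V)) (fun U => \1%VF)
  (fun U V W g f => (g \o f)%VF) _ _ _).
- by move=> *; exact: comp_lfun1r.
- by move=> *; exact: comp_lfun1l.
- by move=> *; exact: comp_lfunA.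
Defined.

Definition pmod (R : realType) (K : fieldType) : category :=
  Rfun_category R (vect K).

Definition pmod_delta_trivial (R : realType) (K : fieldType) (delta : R)
  (M : pmod R K) : Prop := @delta_trivial R (vect K) delta M.

(* Reading off the spaces and linear maps underlying objects and morphisms of
   [pmod R K]. *)
Definition pspace (R : realType) (K : fieldType) (M : pmod R K) (t : R) :
  vectType K := fob M t.
Definition pmap (R : realType) (K : fieldType) (M : pmod R K) (s t : R)
  (h : s <= t) : 'Hom(pspace M s, pspace M t) := fmap M h.
Definition plin (R : realType) (K : fieldType) (M N : pmod R K) (f : Mor M N)
  (t : R) : 'Hom(pspace M t, pspace N t) := ntmap f t.

Section Image.
Variables (R : realType) (K : fieldType) (M N : pmod R K) (f : Mor M N).

Definition im_space (t : R) : {vspace pspace N t} := limg (plin f t).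

Definition im_map (s t : R) (h : s <= t) :
    'Hom(subvs_of (im_space s), subvs_of (im_space t)) :=
  linfun (vsproj (im_space t) \o (pmap N h \o @vsval _ _ (im_space s))).

Lemma im_mapE (s t : R) (h : s <= t) (u : subvs_of (im_space s)) :
  vsval (im_map h u) = pmap N h (vsval u).
Proof.
rewrite lfunE /= vsprojK //.
have /memv_imgP[v _ ->] := subvsP u.
have /lfunP/(_ v) := ntmapP f h; rewrite /= !comp_lfunE /= => e.
by rewrite /pmap /plin -e; apply: memv_img; apply: memvf.
Qed.

Definition image_module : pmod R K.
Proof.
refine (@RFunctor R (vect K) (fun t => subvs_of (im_space t)) im_map _ _).
- move=> t h; apply/lfunP => u; apply: val_inj.
  by rewrite /= im_mapE id_lfunE /pmap fmap_id /= id_lfunE.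
- move=> s t u h1 h2 h3; apply/lfunP => v; apply: val_inj.
  by rewrite /= comp_lfunE !im_mapE /pmap (fmap_comp N h1 h2 h3) comp_lfunE.
Defined.

End Image.

(** * Intervals and the modules they define *)

Record itvl (R : realType) := Itvl {
  iset :> R -> Prop;
  iset_nonempty : exists t, iset t;
  iset_convex : forall a b c, iset a -> iset c -> a < b -> b < c -> iset b }.

HB.instance Definition _ (R : realType) := gen_eqMixin (itvl R).
HB.instance Definition _ (R : realType) := gen_choiceMixin (itvl R).

Section IntervalModule.
Variables (R : realType) (K : fieldType) (I : itvl R).

(* [K^I] has the one-dimensional space ['rV_1] at the indices in [I] and
   ['rV_0] elsewhere; [const_mx 1] is the identity matrix in format 1 x 1 and
   the only matrix in the formats 0 x 0, 0 x 1 and 1 x 0. *)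
Definition itv_dim (t : R) : nat := `[< I t >].

Definition itv_map (s t : R) : 'Hom('rV[K]_(itv_dim s), 'rV[K]_(itv_dim t)) :=
  linfun (mulmxr (const_mx 1)).

Definition interval_module : pmod R K.
Proof.
refine (@RFunctor R (vect K) (fun t => 'rV[K]_(itv_dim t))
  (fun s t _ => itv_map s t) _ _).
- move=> t h; apply/lfunP => u; rewrite lfunE id_lfunE /=.
  move: u; rewrite /itv_dim; case: asboolP => _ u.
    by rewrite (_ : const_mx 1 = 1%:M) ?mulmx1 //; apply/matrixP => i j;
       rewrite !mxE !ord1.
  by rewrite [LHS]thinmx0 [RHS]thinmx0.
- move=> s t u st tu su; apply/lfunP => v; rewrite comp_lfunE !lfunE /=.
  rewrite -mulmxA; congr (_ *m _).
  have : I s -> I u -> I t.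
    move=> Is Iu; have [->//|nst] := eqVneq t s.
    have [->//|ntu] := eqVneq t u.
    by apply: (iset_convex Is Iu); rewrite lt_neqAle ?st ?tu andbT // eq_sym.
  rewrite /itv_dim; case: (asboolP (I s)) => Is; last by move=> _; apply/matrixP => [[]].
  case: (asboolP (I u)) => Iu; last by move=> _; apply/matrixP => i [].
  case: (asboolP (I t)) => It; last by move=> /(_ Is Iu).
  by move=> _; apply/matrixP => i j; rewrite !mxE big_ord1 !mxE mulr1.
Defined.

End IntervalModule.

(* [inj] exhibits [M] as the direct sum of the family [F]: at every index [t],
   the canonical map from the direct sum of the spaces [F x t] (families [w] of
   finite support) to [M t] is bijective. *)
Definition is_direct_sum (R : realType) (K : fieldType) (X : choiceType)
    (F : X -> pmod R K) (M : pmod R K) (inj : forall x, Mor (F x) M) : Prop :=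
  forall (t : R) (v : pspace M t),
    exists! w : forall x, pspace (F x) t,
      finite_set [set x | w x != 0] /\
      v = \sum_(x \in [set: X]) plin (inj x) t (w x).

(** * Barcodes *)

Section Barcodes.
Variable R : realType.
Implicit Types I J : itvl R.

Definition bounds_above I J : Prop :=
  forall s, J s -> exists t, I t /\ s <= t.
Definition bounds_below J I : Prop :=
  forall t, I t -> exists s, J s /\ s <= t.

Definition coincide_above I J : Prop := bounds_above I J /\ bounds_above J I.
Definition coincide_below I J : Prop := bounds_below I J /\ bounds_below J I.

Definition overlaps_above I J : Prop :=
  [/\ (exists t, I t /\ J t), bounds_above I J & bounds_below J I].

Record barcode := Barcode {
  bindex : Type;
  bset : set (itvl R * bindex) }.
Arguments bset : clear implicits.

Definition belt (C : barcode) : Type := set_type (bset C).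
Definition bitv (C : barcode) (x : belt C) : itvl R := (val x).1.

Definition nat_barcode (B : set (itvl R * nat)) : barcode := Barcode B.

(* The indices of each interval form a prefix of {1, 2, ...}. *)
Definition natural (B : set (itvl R * nat)) : Prop :=
  forall I n, B (I, n) ->
    (0 < n)%N /\ forall m, (0 < m <= n)%N -> B (I, m).

End Barcodes.

(* [B] is the barcode B(M) of [M]. By the structure theorem for p.f.d. modules
   there is exactly one such [B] for each [M]; a statement about B(M) is
   therefore rendered as a statement about any [B] with this property. *)
Definition is_barcode_of (R : realType) (K : fieldType) (M : pmod R K)
    (B : set (itvl R * nat)) : Prop :=
  natural B /\
  exists inj : forall x : set_type B, Mor (interval_module K (val x).1) M,
    is_direct_sum inj.

(** * Matchings *)

Record matching (S T : Type) := Matching {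
  mrel :> S -> T -> Prop;
  mrel_fun : forall x y y', mrel x y -> mrel x y' -> y = y';
  mrel_inj : forall x x' y, mrel x y -> mrel x' y -> x = x' }.

Lemma matching_eq (S T : Type) (f g : matching S T) :
  (forall x y, f x y <-> g x y) -> f = g.
Proof.
case: f g => [f f1 f2] [g g1 g2] /= fg.
have e : f = g.
  by apply/funext => x; apply/funext => y; apply/propext; exact: fg.
by subst g; congr Matching; apply: Prop_irrelevance.
Qed.

Definition rel_comp (S T U : Type) (g : T -> U -> Prop) (f : S -> T -> Prop)
  (x : S) (z : U) : Prop := exists y, f x y /\ g y z.

Definition matching_id (S : Type) : matching S S.
Proof. by exists eq => [x y y' <- <-|x x' y -> ->]. Defined.

Definition matching_comp (S T U : Type)
  (g : matching T U) (f : matching S T) : matching S U.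
Proof.
exists (rel_comp g f).
- move=> x z z' [y [xy yz]] [y' [xy' yz']].
  by move: yz'; rewrite -(mrel_fun xy xy') => /(mrel_fun yz).
- move=> x x' z [y [xy yz]] [y' [xy' yz']].
  by move: xy'; rewrite -(mrel_inj yz yz') => /(mrel_inj xy).
Defined.

Definition Mch : category.
Proof.
refine (@Category Type matching matching_id matching_comp _ _ _).
- by move=> S T f; apply: matching_eq => x y; split=> [[_ [<-]]|] //; exists x.
- by move=> S T f; apply: matching_eq => x y;
     split=> [[z [xz <-]]|] //; exists y.
- move=> S T U V h g f; apply: matching_eq => x y; split.
  + by move=> [z [[w [? ?]] ?]]; exists w; split=> //; exists z.
  + by move=> [w [? [z [? ?]]]]; exists z; split=> //; exists w.
Defined.

(** * The category of barcodes and overlap matchings *)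

Section Barc.
Variable R : realType.
Implicit Types C D : barcode R.

Record overlap_matching C D := OverlapMatching {
  omatch :> matching (belt C) (belt D);
  omatchP : forall x y, omatch x y -> overlaps_above (bitv x) (bitv y) }.

Lemma overlap_matching_eq C D (f g : overlap_matching C D) :
  (forall x y, f x y <-> g x y) -> f = g.
Proof.
case: f g => [f fP] [g gP] /= fg.
have e : f = g by exact: matching_eq.
by subst g; congr OverlapMatching; apply: Prop_irrelevance.
Qed.

Lemma overlaps_above_refl (I : itvl R) : overlaps_above I I.
Proof.
have [t It] := iset_nonempty I.
by split; [exists t | move=> s Is; exists s | move=> s Is; exists s].
Qed.

Lemma overlaps_above_midl (I J J' L : itvl R) :
  overlaps_above I J -> overlaps_above J J' -> overlaps_above J' L ->
  overlaps_above I L -> overlaps_above I J'.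
Proof.
move=> [_ IJa IJb] [_ JJa JJb] [_ JLa JLb] [[t [It Lt]] _ _].
split.
- exists t; split=> //.
  have [s [Js st]] : exists s, J' s /\ s <= t.
    have [u [Ju ut]] := IJb _ It; have [s [Js su]] := JJb _ Ju.
    by exists s; split=> //; exact: le_trans ut.
  have [r [Jr tr]] := JLa _ Lt.
  have [<-//|nst] := eqVneq s t; have [->//|ntr] := eqVneq t r.
  by apply: (iset_convex Js Jr); rewrite lt_neqAle ?nst ?ntr.
- move=> s /JJa[u [/IJa[v [Iv uv]] su]].
  by exists v; split=> //; exact: le_trans uv.
- move=> s /IJb[u [/JJb[v [Jv vu]] us]].
  by exists v; split=> //; exact: le_trans us.
Qed.

Lemma overlaps_above_midr (I J J' L : itvl R) :
  overlaps_above I J -> overlaps_above J J' -> overlaps_above J' L ->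
  overlaps_above I L -> overlaps_above J L.
Proof.
move=> [_ IJa IJb] [_ JJa JJb] [_ JLa JLb] [[t [It Lt]] _ _].
split.
- exists t; split=> //.
  have [s [Js st]] := IJb _ It.
  have [r [Jr tr]] : exists r, J r /\ t <= r.
    have [u [Ju ut]] := JLa _ Lt; have [r [Jr su]] := JJa _ Ju.
    by exists r; split=> //; exact: le_trans su.
  have [<-//|nst] := eqVneq s t; have [->//|ntr] := eqVneq t r.
  by apply: (iset_convex Js Jr); rewrite lt_neqAle ?nst ?ntr.
- move=> s /JLa[u [/JJa[v [Iv uv]] su]].
  by exists v; split=> //; exact: le_trans uv.
- move=> s /JJb[u [/JLb[v [Jv vu]] us]].
  by exists v; split=> //; exact: le_trans us.
Qed.

Definition overlap_id C : overlap_matching C C.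
Proof.
by exists (matching_id (belt C)) => x _ <-; exact: overlaps_above_refl.
Defined.

Definition overlap_comp C D E
  (g : overlap_matching D E) (f : overlap_matching C D) :
  overlap_matching C E.
Proof.
unshelve eexists.
- exists (fun x z => rel_comp g f x z /\ overlaps_above (bitv x) (bitv z)).
  + by move=> x z z' [h _] [h' _]; exact: (@mrel_fun _ _ (matching_comp g f)) h h'.
  + by move=> x x' z [h _] [h' _]; exact: (@mrel_inj _ _ (matching_comp g f)) h h'.
- by move=> x z [].
Defined.

Definition Barc : category.
Proof.
refine (@Category (barcode R) overlap_matching overlap_id overlap_comp _ _ _).
- move=> C D f; apply: overlap_matching_eq => x y; split=> [[[_ [<-]]]|xy] //.
  by split; [exists x | exact: omatchP xy].
- move=> C D f; apply: overlap_matching_eq => x y.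
  split=> [[[z [xz <-]]]|xy] //; by split; [exists y | exact: omatchP xy].
- move=> C D E F h g f; apply: overlap_matching_eq => x y; split.
  + move=> [[z [[[w [xw wz]] xz] zy]] xy]; split=> //.
    exists w; split=> //; split; first by exists z.
    exact: (overlaps_above_midr (omatchP xw) (omatchP wz) (omatchP zy) xy).
  + move=> [[w [xw [[z [wz zy]] wy]]] xy]; split=> //.
    exists z; split=> //; split; first by exists w.
    exact: (overlaps_above_midl (omatchP xw) (omatchP wz) (omatchP zy) xy).
Defined.

(* The functor E(C) : R -> Mch. *)
Definition bfun_ob C (t : R) : Type := {x : belt C | bitv x t}.

Definition bfun_map C (s t : R) : matching (bfun_ob C s) (bfun_ob C t).
Proof.
exists (fun x y => sval x = sval y) => [x y y'|x x' y].
- by move=> -> /eq_sig_hprop; apply=> *; exact: Prop_irrelevance.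
- by move=> <- e; apply/esym/eq_sig_hprop; [move=> *; exact: Prop_irrelevance|].
Defined.

Definition bfun C : Rfunctor R Mch.
Proof.
refine (@RFunctor R Mch (bfun_ob C) (fun s t _ => bfun_map C s t) _ _).
- move=> t h; apply: matching_eq => x y; split=> [e|-> //].
  by apply: eq_sig_hprop e => *; exact: Prop_irrelevance.
- move=> s t u st tu su; apply: matching_eq => -[x xs] [y yu] /=.
  split=> [/= e|[[z zt] /= [-> ->]] //]; subst y.
  have xt : bitv x t.
    have [->//|nst] := eqVneq t s; have [->//|ntu] := eqVneq t u.
    by apply: (iset_convex xs yu); rewrite lt_neqAle ?st ?tu andbT // eq_sym.
  by exists (exist _ x xt).
Defined.

Definition barcode_delta_trivial (delta : R) (C : Barc) : Prop :=
  delta_trivial delta (bfun C).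

End Barc.

(** * Induced matchings *)

Section InducedMatching.
Variable R : realType.
Implicit Types B C D : set (itvl R * nat).

Definition bar_lt (x y : itvl R * nat) : Prop :=
  (iset y.1 `<` iset x.1) \/ (x.1 = y.1 /\ (x.2 < y.2)%N).

(* [x] is the [i]th element of [A] with respect to [bar_lt], counting from 1:
   exactly [i] elements of [A] precede or equal [x]. *)
Definition ith_element (A : set (itvl R * nat)) (i : nat) (x : itvl R * nat)
  : Prop := A x /\ [set y | A y /\ (bar_lt y x \/ y = x)] #= `I_i.

(* The elements of [B] in the class of [I] under the equivalence [coin]. *)
Definition class_of (coin : itvl R -> itvl R -> Prop) B (I : itvl R) :
  set (itvl R * nat) := [set x | B x /\ coin x.1 I].

Definition match_by_class (coin : itvl R -> itvl R -> Prop) C D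
    (x y : itvl R * nat) : Prop :=
  exists (I : itvl R) (i : nat),
    ith_element (class_of coin C I) i x /\ ith_element (class_of coin D I) i y.

(* The matchings induced by monomorphisms and epimorphisms only depend on the
   barcodes [C], [D] of the source and the target. *)
Definition mono_matching := match_by_class (@coincide_above R).
Definition epi_matching := match_by_class (@coincide_below R).

(* The induced matching of [f : M -> N], in terms of the barcodes of [M], of
   [image_module f] and of [N]. *)
Definition induced_matching (BM Bim BN : set (itvl R * nat)) :
    itvl R * nat -> itvl R * nat -> Prop :=
  rel_comp (mono_matching Bim BN) (epi_matching BM Bim).

End InducedMatching.

(* Main.v *)
(** For intervals of one class (coinciding below, say), those containing [t]
    come first in the order used to define the induced matching. So everything
    reduces to comparing, for the modules [M], [im f] and [N], the number of
    intervals of a class [e] that contain a given point. If [s] lies in the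
    intervals of [e] and [s'] below them, both close enough to the common lower
    end, then the number of intervals of [e] containing [t] is the difference
    [rank (M s -> M t) - rank (M s' -> M t)]; dually above. All the comparisons
    needed are then instances of the Frobenius inequality
    [rank (a b) + rank (b c) <= rank b + rank (a b c)]: with [e(P, t)] for the
    number of intervals of [B(P)] in [e] that contain [t],
    - [e(im f, t) <= e(M, t)], and [e(M, t + delta) <= e(im f, t)] if the kernel
      of [f] is [delta]-trivial, so that [M t -> M (t + delta)] factors through
      [im f] at [t] (classes below);
    - [e(im f, t) <= e(N, t)], and [e(N, t) <= e(im f, t + delta)] if the cokernel
      is [delta]-trivial, so that [N t -> N (t + delta)] lifts to [im f] at
      [t + delta] (classes above).
    In [Barc] a matching [X] has the kernel formed by the intervals [I \ X(I)]
    and the cokernel formed by the intervals [J \ X^-1(J)]. *)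

Require Import Defs.
From mathcomp Require Import all_boot all_order all_algebra.
From mathcomp Require Import finmap boolp classical_sets functions cardinality.
From mathcomp Require Import fsbigop reals zify.

Set Implicit Arguments.
Unset Strict Implicit.
Unset Printing Implicit Defensive.

Import Order.TTheory GRing.Theory Num.Theory.
Local Open Scope classical_set_scope.
Local Open Scope card_scope.
Local Open Scope ring_scope.

(** * Rank of a linear map *)

Definition lrank (K : fieldType) (U V : vectType K) (g : 'Hom(U, V)) : nat :=
  \dim (limg g).

(** Composing with [a] lowers a rank by the dimension of a subspace of [lker a]; the one met by the
    image of [b \o c] lies in the one met by the image of [b]. *)
Lemma lrank_frobenius (K : fieldType) (U V W Z : vectType K) (a : 'Hom(W, Z))
    (b : 'Hom(V, W)) (c : 'Hom(U, V)) :
  (lrank (a \o b) + lrank (b \o c) <= lrank b + lrank (a \o (b \o c)))%N.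
Proof.
rewrite /lrank !limg_comp; set S := limg b; set S' := (b @: limg c)%VS.
have sS : (S' <= S)%VS by apply: limgS; apply: subvf.
have := limg_ker_dim a S; have := limg_ker_dim a S'.
have := dimvS (capvS sS (subvv (lker a))).
by move=> ? <- <-; lia.
Qed.

(** * Ranks of the internal maps *)

Section BarBasis.
Variables (R : realType) (K : fieldType) (M : pmod R K) (X : choiceType).
Variables (I : X -> itvl R) (inj : forall x, Mor (interval_module K (I x)) M).
Hypothesis injP : is_direct_sum inj.

(** A generator of the line at [t] inside the interval; outside it, the same formula is the zero
    vector. *)
Definition itv_one (x : X) (t : R) : pspace (interval_module K (I x)) t :=
  (const_mx 1 : 'rV[K]_(itv_dim (I x) t)).

Lemma itv_oneZ x t (v : pspace (interval_module K (I x)) t) :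
  exists c, v = c *: itv_one x t.
Proof.
move: v; rewrite /itv_one /pspace /= /itv_dim; case: asboolP => _ v; last first.
  by exists 0; apply/matrixP => i [].
by exists (v 0 0); apply/matrixP => i j; rewrite !mxE !ord1 mulr1.
Qed.

Lemma itv_one_neq0 x t : I x t -> itv_one x t != 0.
Proof.
move=> Ixt; apply/eqP; rewrite /itv_one /pspace /= /itv_dim asboolT //.
by move/matrixP/(_ 0 0); rewrite !mxE => /eqP; rewrite oner_eq0.
Qed.

Lemma itv_one_eq0 x t : ~ I x t -> itv_one x t = 0.
Proof.
move=> Ixt; rewrite /itv_one /pspace /= /itv_dim asboolF //.
by apply/matrixP => i [].
Qed.

Definition bar_gen (t : R) (x : X) : pspace M t := plin (inj x) t (itv_one x t).

Lemma pmap_bar_gen s t (h : s <= t) x : I x s ->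
  Defs.pmap M h (bar_gen s x) = bar_gen t x.
Proof.
move=> Ixs; have /lfunP/(_ (itv_one x s)) := ntmapP (inj x) h.
rewrite !comp_lfunE => <-; rewrite /bar_gen /plin.
have -> : fmap (interval_module K (I x)) h (itv_one x s) = itv_one x t.
  rewrite /= lfunE /= /itv_one /itv_dim (asboolT Ixs).
  case: (asboolP (I x t)) => _; apply/matrixP => i [] //= j ?.
  by rewrite !mxE big_ord1 !mxE mulr1.
by [].
Qed.

Lemma fsum_plin_inj t (w : forall x, pspace (interval_module K (I x)) t)
    (L : seq X) : uniq L -> (forall x, w x != 0 -> x \in L) ->
  \sum_(x \in [set: X]) plin (inj x) t (w x)
    = \sum_(x <- L) plin (inj x) t (w x).
Proof.
move=> uL wL; rewrite (fsbigE L) //=; last first.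
  move=> x _ xL; suff -> : w x = 0 by rewrite linear0.
  by apply/eqP; apply: contraNT xL => /wL.
by apply: eq_bigl => x; rewrite in_setT.
Qed.

(** A linear relation, extended by zero, decomposes 0 in the direct sum, where 0 has only the zero
    decomposition. *)
Lemma bar_gen_free t (L : seq X) : uniq L -> (forall x, x \in L -> I x t) ->
  free (map (bar_gen t) L).
Proof.
move=> uL LI; have [->|[x0 _]] : L = [::] \/ exists x0, x0 \in L.
- by case: (L) => [|x l]; [left|right; exists x; rewrite mem_head].
- by rewrite /= nil_free.
apply/(@freeP _ _ _ (in_tuple (map (bar_gen t) L))) => k k0 i.
(* [k] is indexed by positions in [L]; [c] makes it a function on [X], zero off [L]. *)
pose c x := if insub (index x L) is Some j then k j else 0.
pose w x : pspace (interval_module K (I x)) t := c x *: itv_one x t.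
have wL x : w x != 0 -> x \in L.
  apply: contraNT => xL; rewrite /w /c insubF ?scale0r //.
  by rewrite size_map index_mem (negbTE xL).
have [v [[_ v0] vu]] := injP (0 : pspace M t).
have vw : v = w.
  apply: vu; split.
    by apply: (sub_finite_set _ (finite_seq L)) => x /wL.
  rewrite (fsum_plin_inj uL wL) (big_nth x0) -(size_map (bar_gen t)) big_mkord.
  rewrite -[LHS]k0; apply: eq_bigr => j _.
  have jL : (j < size L)%N by rewrite -(size_map (bar_gen t)).
  rewrite (nth_map x0) // /w linearZ /c index_uniq //; congr (_ *: _).
  by rewrite insubT // => ?; congr k; apply: val_inj.
have v_eq0 : v = fun x => 0.
  apply: vu; split.
    by rewrite (_ : [set x | _] = set0) // -subset0 => x /=; rewrite eqxx.
  by rewrite fsbig1 // => x _; rewrite linear0.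
have iL : (i < size L)%N.
  by have := ltn_ord i; rewrite [X in (_ < X)%N -> _]size_map.
have := congr1 (fun w => w (nth x0 L i)) (etrans (esym vw) v_eq0).
move=> /eqP; rewrite /w scaler_eq0 (negbTE (itv_one_neq0 _)) ?orbF; last first.
  by apply: LI; apply: mem_nth.
rewrite /c index_uniq // insubT; first exact: ltn_ord.
by move=> iL' /eqP; rewrite (_ : Sub _ _ = i) //; apply: val_inj.
Qed.

Lemma bar_gen_span t (v : pspace M t) :
  exists L : seq X, (forall x, x \in L -> I x t) /\ v \in <<map (bar_gen t) L>>%VS.
Proof.
have [w [[/finite_seqP[L wL] ->] _]] := injP v.
have LE x : (x \in undup L) = (w x != 0).
  rewrite mem_undup; have /= e := congr1 (fun A : set X => A x) wL.
  by apply/idP/idP; rewrite e.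
exists (undup L); split=> [x|].
  rewrite LE => w0; apply: contrapT => /itv_one_eq0 e.
  by have [c wc] := itv_oneZ (w x); rewrite wc e scaler0 eqxx in w0.
rewrite (@fsum_plin_inj t w (undup L)) ?undup_uniq // => [|x]; last by rewrite LE.
rewrite big_seq; apply: rpred_sum => x xL.
have [c ->] := itv_oneZ (w x); rewrite linearZ rpredZ //.
by apply: memv_span; apply: map_f.
Qed.

(** The generators of the intervals through [t] are free, so the dimension of [M t] bounds their
    number. *)
Lemma bars_at_exists t : exists L : seq X,
  uniq L /\ forall x, x \in L <-> I x t.
Proof.
suff /finite_seqP[L LE] : finite_set [set x | I x t].
  exists (undup L); split=> [|x]; first exact: undup_uniq.
  by rewrite mem_undup -[I x t]/([set x | I x t] x) LE.
apply: contrapT => /(infinite_set_fset (\dim {:pspace M t}).+1)[F FI].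
apply/negP; rewrite -ltnNge ltnS.
have /eqP : free (map (bar_gen t) F) by apply: bar_gen_free => // x /FI.
by rewrite size_map => <-; apply: dimvS; apply: subvf.
Qed.

Lemma bar_gen_basis t (L : seq X) : uniq L -> (forall x, x \in L <-> I x t) ->
  basis_of fullv (map (bar_gen t) L).
Proof.
move=> uL LI; apply/andP; split; last by apply: bar_gen_free => // x /LI.
rewrite eqEsubv subvf /=; apply/subvP => v _.
have [L' [L'I]] := bar_gen_span v; apply: subvP; apply: sub_span => _ /mapP[x xL' ->].
by apply: map_f; apply/LI; apply: L'I.
Qed.

(** The basis vector of an interval at [s] goes to its generator at [t], which vanishes if [t] is
    outside; the remaining generators are free. *)
Lemma lrank_pmap s t (h : s <= t) (L : seq X) : uniq L ->
  (forall x, x \in L <-> I x s) ->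
  lrank (Defs.pmap M h) = count (fun x => `[< I x t >]) L.
Proof.
move=> uL LI; have /andP[/eqP sL _] := bar_gen_basis uL LI.
set L' := [seq x <- L | `[< I x t >]].
have /eqP fL' : free (map (bar_gen t) L').
  by apply: bar_gen_free => [|x]; rewrite ?filter_uniq // mem_filter => /andP[/asboolP].
rewrite -size_filter -/L' -(size_map (bar_gen t)) -fL' /lrank -sL limg_span -map_comp.
congr (\dim _); apply/eqP; rewrite eqEsubv; apply/andP; split.
  apply/span_subvP => _ /mapP[x xL ->] /=; rewrite pmap_bar_gen; last exact/LI.
  have [xt|xt] := pselect (I x t).
    by apply: memv_span; apply: map_f; rewrite mem_filter xL andbT; apply/asboolP.
  by rewrite /bar_gen itv_one_eq0 // linear0 mem0v.
apply: sub_span => _ /mapP[x + ->]; rewrite mem_filter => /andP[_ xL].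
by apply/mapP; exists x => //=; rewrite pmap_bar_gen //; apply/LI.
Qed.

Lemma lrank_pmap_tgt s t (h : s <= t) (L : seq X) : uniq L ->
  (forall x, x \in L <-> I x t) ->
  lrank (Defs.pmap M h) = count (fun x => `[< I x s >]) L.
Proof.
move=> uL LI; have [L' [uL' L'I]] := bars_at_exists s.
rewrite (lrank_pmap h uL' L'I) -!size_filter; apply/perm_size/uniq_perm.
- exact: filter_uniq.
- exact: filter_uniq.
move=> x; rewrite !mem_filter; apply/andP/andP => -[/asboolP xs xL].
- by split; [apply/asboolP/L'I|apply/LI].
- by split; [apply/asboolP/LI|apply/L'I].
Qed.

End BarBasis.

Definition bars_at (R : realType) (B : set (itvl R * nat)) (t : R)
    (L : seq (itvl R * nat)) : Prop :=
  uniq L /\ forall x, x \in L <-> B x /\ x.1 t.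

Definition stab_count (R : realType) (t : R) (L : seq (itvl R * nat)) : nat :=
  count (fun x : itvl R * nat => `[< x.1 t >]) L.

(** A single list, taken at [t], yields the ranks of all maps into and out of [t], so that ranks for
    different [s] count members of the same list. *)
Lemma barcode_rank (R : realType) (K : fieldType) (M : pmod R K)
    (B : set (itvl R * nat)) (t : R) : is_barcode_of M B ->
  exists L : seq (itvl R * nat), [/\ bars_at B t L,
    forall s (h : s <= t), lrank (Defs.pmap M h) = stab_count s L &
    forall u (h : t <= u), lrank (Defs.pmap M h) = stab_count u L].
Proof.
move=> [_ [inj injP]]; have [L [uL LI]] := bars_at_exists injP t.
exists (map val L); split.
- split=> [|x]; first by rewrite map_inj_uniq //; apply: val_inj.
  split=> [/mapP[y yL ->]|[Bx xt]].
    by split; [exact: set_mem (valP y)|apply/LI].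
  by apply/mapP; exists (SigSub (mem_set Bx)) => //; apply/LI.
- by move=> s h; rewrite (lrank_pmap_tgt injP h uL LI) /stab_count count_map.
- by move=> s h; rewrite (lrank_pmap injP h uL LI) /stab_count count_map.
Qed.

Lemma bars_at_barcode (R : realType) (K : fieldType) (M : pmod R K)
    (B : set (itvl R * nat)) : is_barcode_of M B ->
  forall t, exists L, bars_at B t L.
Proof. by move=> BM t; have [L []] := barcode_rank t BM; exists L. Qed.

Lemma lrank_image_module (R : realType) (K : fieldType) (M N : pmod R K)
    (f : Mor M N) s t (h : s <= t) :
  lrank (Defs.pmap (image_module f) h) = lrank (plin f t \o Defs.pmap M h)%VF.
Proof.
(* The inclusion of the image in [N]: it is injective, so the rank may be computed in [N]. *)
pose v t : 'Hom(subvs_of (im_space f t), pspace N t) := linfun vsval.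
have v_inj U : \dim (v t @: U) = \dim U.
  apply: limg_dim_eq; apply/eqP; rewrite -subv0; apply/subvP => u.
  by rewrite memv_cap memv_ker lfunE memv0 => /andP[_ /eqP u0]; apply/eqP/val_inj.
have -> : (plin f t \o Defs.pmap M h)%VF = (Defs.pmap N h \o plin f s)%VF.
  exact: (ntmapP f h).
rewrite /lrank -v_inj -limg_comp.
have -> : (v t \o Defs.pmap (image_module f) h)%VF = (Defs.pmap N h \o v s)%VF.
  apply/lfunP => u; rewrite !comp_lfunE [LHS]lfunE [X in _ = _ X]lfunE.
  exact: im_mapE.
rewrite !limg_comp; congr (\dim (_ @: _)); apply/vspaceP => u.
apply/memv_imgP/idP => [[w _ ->]|uI]; first by rewrite lfunE; apply: subvsP.
by exists (vsproj (im_space f s) u); rewrite ?memvf // lfunE /= vsprojK.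
Qed.

(** * Counting intervals in a class *)

(* The order of [R] or its converse, so that coincidence below and coincidence
   above, kernels and cokernels are treated at once. *)
Record side (R : realType) := Side {
  side_le :> R -> R -> Prop;
  side_refl : forall a, side_le a a;
  side_tran : forall a b c, side_le a b -> side_le b c -> side_le a c;
  side_tot : forall a b, side_le a b \/ side_le b a;
  side_conv : forall (I : itvl R) a b c,
    I a -> I c -> side_le a b -> side_le b c -> I b }.

Lemma itvl_le_conv (R : realType) (I : itvl R) a b c :
  I a -> I c -> a <= b -> b <= c -> I b.
Proof.
move=> Ia Ic; rewrite le_eqVlt => /predU1P[<- //|ab].
by rewrite le_eqVlt => /predU1P[-> //|bc]; apply: (iset_convex Ia Ic).
Qed.

Definition below (R : realType) : side R :=
  @Side R (fun a b => a <= b) (@lexx _ R) (fun a b c => @le_trans _ R b a c)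
    (fun a b => orP (le_total a b)) (@itvl_le_conv R).

Definition flip (R : realType) (le : side R) : side R :=
  @Side R (fun a b => le b a) (side_refl le)
    (fun a b c ab bc => side_tran bc ab) (fun a b => side_tot le b a)
    (fun I a b c Ia Ic ab bc => side_conv Ic Ia bc ab).

Definition above (R : realType) : side R := flip (below R).

Section Counting.
Variable R : realType.
Implicit Types (I J : itvl R) (L : seq (itvl R * nat)).

Lemma itvl_ext I J : (forall t, I t <-> J t) -> I = J.
Proof.
case: I J => [I I1 I2] [J J1 J2] /= IJ.
have e : I = J by apply/funext => t; apply/propext; exact: IJ.
by subst J; congr Itvl; apply: Prop_irrelevance.
Qed.

Variable le : side R.

Let le_refl := side_refl le.
Let le_tran := @side_tran R le.
Let le_tot := side_tot le.
Let itvl_conv := @side_conv R le.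

(* This is [bounds_below I J] when [le] is [below R], and [bounds_above I J]
   when it is [above R]; similarly for [coincide]. *)
Definition bounds I J : Prop := forall t, J t -> exists s, I s /\ le s t.
Definition coincide I J : Prop := bounds I J /\ bounds J I.

Lemma bounds_trans J I I' : bounds I J -> bounds J I' -> bounds I I'.
Proof.
by move=> IJ JI' t /JI'[s [/IJ[r [? rs]] st]]; exists r; split=> //; apply: le_tran st.
Qed.

Lemma coincide_refl I : coincide I I.
Proof. by split=> t ?; exists t. Qed.

Lemma coincide_sym I J : coincide I J -> coincide J I.
Proof. by case. Qed.

Lemma coincide_trans J I I' : coincide I J -> coincide J I' -> coincide I I'.
Proof. by move=> [? ?] [? ?]; split; apply: (@bounds_trans J). Qed.

(** A point of [I] missing from [J] lies past all of [J], since [J] reaches back to the common end;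
    convexity of [I] then yields all of [J]. *)
Lemma coincide_nested I J : coincide I J ->
  (forall t, I t -> J t) \/ (forall t, J t -> I t).
Proof.
move=> [IJ JI].
have [?|/existsNP[a /not_implyP[Ia Ja]]] := pselect (forall t, I t -> J t).
  by left.
right=> b Jb; have [ab|ba] := le_tot a b.
  by have [j [Jj ja]] := JI _ Ia; case: Ja; apply: itvl_conv Jj Jb ja ab.
by have [i [Ii ib]] := IJ _ Jb; apply: itvl_conv Ii Ia ib ba.
Qed.

(** A listed interval that does not bound [I] stays past some point of [I]; the extreme such point
    over the finite list serves for all. *)
Lemma exists_inner I s0 L : I s0 -> exists s, [/\ I s, le s s0 &
  forall x, x \in L -> ~ bounds x.1 I -> forall r, x.1 r -> ~ le r s].
Proof.
move=> Is0; elim: L => [|x L [s [Is ss0 sL]]]; first by exists s0.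
have [bx|/existsNP[a /not_implyP[Ia /forallNP aP]]] := pselect (bounds x.1 I).
  by exists s; split=> // y; rewrite inE => /predU1P[-> //|/sL].
have a_out r : x.1 r -> ~ le r a by move=> xr ra; apply: (aP r).
have [as_|sa] := le_tot a s.
  exists a; split=> //; first exact: le_tran ss0.
  move=> y; rewrite inE => /predU1P[-> //|/sL yL ny r yr ra].
  by apply: (yL ny r yr); apply: le_tran as_.
exists s; split=> // y; rewrite inE => /predU1P[-> _ r xr rs|/sL //].
by apply: (a_out r xr); apply: le_tran sa.
Qed.

(** A listed interval not bounded by [I] has a point before all of [I]; [s] is the one of these
    points closest to [I]. *)
Lemma exists_outer I L : (forall x, x \in L -> bounds I x.1) \/
  exists s, (forall r, I r -> ~ le r s) /\
    forall x, x \in L -> ~ bounds I x.1 -> exists v, x.1 v /\ le v s.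
Proof.
elim: L => [|x L IHL]; first by left.
have [bx|/existsNP[a /not_implyP[xa /forallNP aP]]] := pselect (bounds I x.1).
  case: IHL => [IHL|[s [Is sL]]]; first by left=> y; rewrite inE => /predU1P[-> |/IHL].
  by right; exists s; split=> // y; rewrite inE => /predU1P[-> |/sL].
have a_out r : I r -> ~ le r a by move=> Ir ra; apply: (aP r).
right; case: IHL => [IHL|[s [Is sL]]].
  exists a; split=> // y; rewrite inE => /predU1P[-> _|/IHL //].
  by exists a.
have [as_|sa] := le_tot a s.
  exists s; split=> // y; rewrite inE => /predU1P[-> _|/sL //].
  by exists a.
exists a; split=> // y; rewrite inE => /predU1P[-> _|/sL yL /yL[v [yv vs]]].
  by exists a.
by exists v; split=> //; apply: le_tran sa.
Qed.

Definition class_count I L : nat :=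
  count (fun x : itvl R * nat => `[< coincide x.1 I >]) L.

(* For [s] in [I] and [s'] outside [I], both close enough to the end point of
   [I], the class of [I] consists of the intervals containing [s] but not [s'];
   there is no such [s'] when no interval of [L1 ++ L2] extends beyond [I]. *)
Lemma class_count_le I s0 L1 L2 : I s0 ->
  (forall x, x \in L1 ++ L2 -> exists u, le s0 u /\ x.1 u) ->
  (forall s, le s s0 -> (stab_count s L1 <= stab_count s L2)%N) ->
  (forall s' s, le s' s -> le s s0 ->
    (stab_count s L1 + stab_count s' L2 <= stab_count s L2 + stab_count s' L1)%N) ->
  (class_count I L1 <= class_count I L2)%N.
Proof.
move=> Is0 meet H0 H1; have [s [Is ss0 sP]] := exists_inner (L1 ++ L2) Is0.
(* By [meet] every listed interval has a point past [s], so it contains [s] as soon as it has a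
   point before [s]. *)
have sE x : x \in L1 ++ L2 -> x.1 s <-> bounds x.1 I.
  move=> xL; split=> [xs|bx].
    by apply: contrapT => nb; apply: (sP x xL nb s xs).
  have [r [xr rs]] := bx _ Is; have [u [s0u xu]] := meet x xL.
  by apply: itvl_conv xr xu rs _; apply: le_tran s0u.
case: (exists_outer I (L1 ++ L2)) => [outP|[s' [s'I s'P]]].
  have cE L : {subset L <= L1 ++ L2} -> class_count I L = stab_count s L.
    move=> sL; apply: eq_in_count => x xL; apply/asboolP/asboolP.
      by move=> [bx _]; apply/sE => //; apply: sL.
    by move=> xs; split; [apply/sE => //; apply: sL|apply: outP; apply: sL].
  by rewrite !cE ?H0 // => x; rewrite mem_cat => ->; rewrite ?orbT.
have s's : le s' s by case: (le_tot s' s) => // /(s'I s Is).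
have s'E x : x \in L1 ++ L2 -> x.1 s' <-> ~ bounds I x.1.
  move=> xL; split=> [xs' bx|nb].
    by have [r [Ir rs]] := bx _ xs'; apply: (s'I r Ir).
  have [v [xv vs']] := s'P x xL nb; have [u [s0u xu]] := meet x xL.
  by apply: itvl_conv xv xu vs' _; apply: le_tran s's _; apply: le_tran s0u.
(* The intervals through [s] bound [I]: those that [I] bounds in turn form the class, the others are
   the ones through [s']. *)
have cE L : {subset L <= L1 ++ L2} ->
    stab_count s L = (class_count I L + stab_count s' L)%N.
  move=> sL; rewrite -count_predUI [X in (_ + X)%N](_ : _ = 0%N) ?addn0.
    apply: eq_in_count => x /sL xL; apply/asboolP/orP.
      move=> /(sE x xL) bx; have [b|nb] := pselect (bounds I x.1).
        by left; apply/asboolP.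
      by right; apply/asboolP/s'E.
    move=> [/asboolP[bx _]|/asboolP xs']; first exact/sE.
    have [u [s0u xu]] := meet x xL.
    by apply: itvl_conv xs' xu s's _; apply: le_tran s0u.
  apply/eqP; rewrite -leqn0 leqNgt -has_count; apply/hasPn => x /sL xL.
  by apply/negP => /andP[/asboolP[_ b] /asboolP/(s'E x xL)].
have := H1 _ _ s's ss0; rewrite !cE; first by lia.
  by move=> x; rewrite mem_cat orbC => ->.
by move=> x; rewrite mem_cat => ->.
Qed.

End Counting.

(** * Positions in a class *)

Lemma card_eq_seq (T : choiceType) (s : seq T) (n : nat) : uniq s ->
  [set` s] #= `I_n <-> size s = n.
Proof.
move=> us; have -> : [set` s] = [set` [fset x in s]%fset].
  by apply/seteqP; split=> x /=; rewrite !inE.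
have -> : size s = #|` [fset x in s]%fset| by rewrite card_fseq undup_id.
by split=> /card_eq_fsetP.
Qed.

Lemma count_lt (T : eqType) (p q : pred T) (s : seq T) y : y \in s ->
  q y -> ~~ p y -> subpred p q -> (count p s < count q s)%N.
Proof.
move=> + qy npy pq; elim: s => [|z s IHs] //=; rewrite inE => /predU1P[<-|/IHs ps].
  by rewrite qy (negbTE npy) add0n add1n ltnS sub_count.
by rewrite -addnS leq_add //; case: (p z) (pq z) => // ->.
Qed.

Section Position.
Variable R : realType.
Implicit Types (I J : itvl R) (x y z : itvl R * nat) (B : set (itvl R * nat)).
Implicit Types (L : seq (itvl R * nat)).

Definition bar_le x y : Prop := bar_lt x y \/ x = y.

Lemma bar_le_sub x y : bar_le x y -> forall t, y.1 t -> x.1 t.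
Proof. by move=> [[[]|[-> _]]|->]. Qed.

Lemma bar_lt_irr x : ~ bar_lt x x.
Proof. by case=> [[]|[_]] //; rewrite ltnn. Qed.

Lemma bar_lt_trans y x z : bar_lt x y -> bar_lt y z -> bar_lt x z.
Proof.
case: x y z => [I m] [J n] [L p]; rewrite /bar_lt /=.
move=> [[JI nIJ]|[-> mn]] [[LJ nJL]|[<- np]].
- by left; split=> [t /LJ/JI //|IL]; apply: nIJ => t /IL/LJ.
- by left.
- by left.
- by right; split=> //; apply: ltn_trans np.
Qed.

Lemma bar_le_trans y x z : bar_le x y -> bar_le y z -> bar_le x z.
Proof.
by move=> [xy|->] // [yz|<-]; left=> //; apply: bar_lt_trans yz.
Qed.

Lemma bar_le_total x y :
  (forall t, x.1 t -> y.1 t) \/ (forall t, y.1 t -> x.1 t) ->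
  bar_lt x y \/ bar_le y x.
Proof.
case: x y => [I m] [J n]; rewrite /bar_le /bar_lt /= => IJ.
have [e|ne] := pselect (I = J).
  subst J; case: (ltngtP m n) => [mn|nm|->]; [left|right;left|right]; right => //.
have nsub : ~ ((forall t, I t -> J t) /\ (forall t, J t -> I t)).
  by move=> [h1 h2]; apply: ne; apply: itvl_ext => t; split; [apply: h1|apply: h2].
case: IJ => [IJ|JI].
  by right; left; left; split=> // JI; apply: nsub.
by left; left; split=> // IJ; apply: nsub.
Qed.

Variable le : side R.

Definition position I x L : nat :=
  count (fun y => `[< coincide le y.1 I /\ bar_le y x >]) L.

(** Whatever precedes [x] has a larger interval, hence contains [t] and occurs in [L]; the
    cardinality becomes a count in a finite list. *)
Lemma ith_elementP B I i x t L : bars_at B t L -> x.1 t ->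
  ith_element (class_of (coincide le) B I) i x <->
    class_of (coincide le) B I x /\ position I x L = i.
Proof.
move=> [uL LP] xt; rewrite /ith_element; set S := (X in X #= _).
have -> : S = [set` [seq y <- L | `[< coincide le y.1 I /\ bar_le y x >]]].
  apply/seteqP; split=> y; rewrite /= mem_filter.
    move=> [[By yI] yx]; apply/andP; split; first exact/asboolP.
    by apply/LP; split=> //; apply: bar_le_sub xt.
  by move=> /andP[/asboolP[yI yx] /LP[By _]].
by rewrite card_eq_seq ?filter_uniq // size_filter.
Qed.

Lemma ith_element_pos B I x t L : bars_at B t L -> x.1 t ->
  class_of (coincide le) B I x ->
  ith_element (class_of (coincide le) B I) (position I x L) x.
Proof. by move=> BL xt Ax; apply/(ith_elementP _ _ BL xt). Qed.

Lemma position_lt I x y L : y \in L -> coincide le y.1 I -> bar_lt x y ->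
  (position I x L < position I y L)%N.
Proof.
move=> yL yI xy; apply: (@count_lt _ _ _ _ y) => //.
- by apply/asboolP; split=> //; right.
- apply/asboolP => -[_ [yx|yx]].
    by apply: (@bar_lt_irr x); apply: bar_lt_trans yx.
  by subst y; apply: (bar_lt_irr xy).
- move=> z /asboolP[zI zx]; apply/asboolP; split=> //.
  by apply: bar_le_trans zx _; left.
Qed.

Lemma class_total B I x y :
  class_of (coincide le) B I x -> class_of (coincide le) B I y ->
  bar_lt x y \/ bar_le y x.
Proof.
move=> [_ xI] [_ yI]; apply/bar_le_total/(@coincide_nested _ le).
exact: coincide_trans xI (coincide_sym yI).
Qed.

Lemma ith_element_inj B I i x y t L : bars_at B t L -> x.1 t -> y.1 t ->
  ith_element (class_of (coincide le) B I) i x ->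
  ith_element (class_of (coincide le) B I) i y -> x = y.
Proof.
move=> BL xt yt /(ith_elementP _ _ BL xt)[Ax xi] /(ith_elementP _ _ BL yt)[Ay yi].
have mem z : class_of (coincide le) B I z -> z.1 t -> z \in L /\ coincide le z.1 I.
  by move=> [Bz zI] zt; split=> //; apply/BL.2.
have [xL xI] := mem _ Ax xt; have [yL yI] := mem _ Ay yt.
have [xy|[yx|->//]] := class_total Ax Ay.
  by have := position_lt yL yI xy; rewrite xi yi ltnn.
by have := position_lt xL xI yx; rewrite xi yi ltnn.
Qed.

(* Intervals of one class are nested, so those containing [t] are the first
   [class_count le I L] elements of the class. *)
Lemma ith_element_exists B I i t L : bars_at B t L ->
  (0 < i <= class_count le I L)%N ->
  exists x, ith_element (class_of (coincide le) B I) i x /\ x.1 t.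
Proof.
move=> BL /andP[i0 iL]; have [uL LP] := BL.
pose F := [seq x <- L | `[< coincide le x.1 I >]].
have FP x : x \in F <-> class_of (coincide le) B I x /\ x.1 t.
  rewrite mem_filter; split=> [/andP[/asboolP xI /LP[Bx xt]]|[[Bx xI] xt]] //.
  by apply/andP; split; [apply/asboolP|apply/LP].
pose r x := position I x L.
have r_inj : {in F &, injective r}.
  move=> x y /FP[Ax xt] /FP[Ay yt] xy.
  apply: (ith_element_inj BL xt yt (ith_element_pos BL xt Ax)).
  by rewrite -/(r x) xy; apply: ith_element_pos.
have ur : uniq (map r F) by rewrite map_inj_in_uniq ?filter_uniq.
have sr : {subset map r F <= iota 1 (size F)}.
  move=> _ /mapP[x /FP[[Bx xI] xt] ->]; rewrite mem_iota add1n ltnS.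
  have xL : x \in L by apply/LP.
  rewrite /r /position -has_count size_filter; apply/andP; split.
    by apply/hasP; exists x => //; apply/asboolP; split=> //; right.
  by apply: sub_count => y /asboolP[yI _]; apply/asboolP.
(* Pigeonhole: the positions are [size F] distinct numbers between 1 and [size F], so each of these
   is attained. *)
have := uniq_min_size ur sr; rewrite size_iota size_map => /(_ (leqnn _))[_ mem_r].
have : i \in map r F by rewrite mem_r mem_iota i0 add1n ltnS size_filter.
move=> /mapP[x /FP[Ax xt] ->]; exists x; split=> //; exact: ith_element_pos.
Qed.

Lemma ith_element_bound B I i x t L : bars_at B t L -> x.1 t ->
  ith_element (class_of (coincide le) B I) i x -> (0 < i <= class_count le I L)%N.
Proof.
move=> BL xt /(ith_elementP _ _ BL xt)[[Bx xI] <-]; apply/andP; split.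
  rewrite /position -has_count; apply/hasP; exists x; first exact/BL.2.
  by apply/asboolP; split=> //; right.
by apply: sub_count => y /asboolP[yI _]; apply/asboolP.
Qed.

Lemma ith_element_transfer B B' I i t s L L' x :
  bars_at B t L -> bars_at B' s L' -> (class_count le I L <= class_count le I L')%N ->
  x.1 t -> ith_element (class_of (coincide le) B I) i x ->
  exists y, ith_element (class_of (coincide le) B' I) i y /\ y.1 s.
Proof.
move=> BL BL' LL' xt /(ith_element_bound BL xt)/andP[i0 iL].
by apply: (ith_element_exists BL'); rewrite i0 (leq_trans iL).
Qed.

End Position.

Section OrderTransfer.
Variable R : realType.
Variable le : side R.

(** Rank inequalities bound the class count at [t] by the one at [t'], so the [i]th element through
    [t] has a counterpart through [t']. The point [u] precedes both, as the two lists may be taken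
    at different points. *)
Lemma ith_element_rank_transfer (B B' : set (itvl R * nat)) (I : itvl R) i t t' u
    L L' (x : itvl R * nat) :
  bars_at B t L -> bars_at B' t' L' -> le u t -> le u t' -> x.1 t -> x.1 u ->
  (forall s, le s u -> (stab_count s L <= stab_count s L')%N) ->
  (forall s' s, le s' s -> le s u ->
    (stab_count s L + stab_count s' L' <= stab_count s L' + stab_count s' L)%N) ->
  ith_element (class_of (coincide le) B I) i x ->
  exists y, ith_element (class_of (coincide le) B' I) i y /\ y.1 t'.
Proof.
move=> BL BL' ut ut' xt xu H0 H1 xi.
have [s0 [Is0 s0u]] : exists s, I s /\ le s u.
  by have [[_ [_ +]] _] := xi; apply.
apply: (ith_element_transfer BL BL' _ xt xi).
apply: (class_count_le Is0).
- move=> z; rewrite mem_cat => /orP[/BL.2|/BL'.2] [_ zt].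
    by exists t; split=> //; apply: side_tran ut.
  by exists t'; split=> //; apply: side_tran ut'.
- by move=> s ss0; apply: H0; apply: side_tran s0u.
- by move=> s' s s's ss0; apply: H1 => //; apply: side_tran s0u.
Qed.

End OrderTransfer.

(** * Comparison of M, im f and N *)

Lemma lrank_compl (K : fieldType) (U V W : vectType K) (a : 'Hom(V, W))
  (b : 'Hom(U, V)) : (lrank (a \o b) <= lrank b)%N.
Proof. by rewrite /lrank limg_comp -(limg_ker_dim a (limg b)) leq_addl. Qed.

Lemma lrank_compr (K : fieldType) (U V W : vectType K) (a : 'Hom(V, W))
  (b : 'Hom(U, V)) : (lrank (a \o b) <= lrank a)%N.
Proof. by rewrite /lrank limg_comp; apply/dimvS/limgS/subvf. Qed.

(** [a^-1] is a linear section of [a] over its image: [v] and [a^-1 (a v)] differ by a vector that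
    [a], hence [b], kills. *)
Lemma lfun_factor (K : fieldType) (U V W : vectType K) (a : 'Hom(U, V))
    (b : 'Hom(U, W)) : (forall v, a v = 0 -> b v = 0) ->
  exists c : 'Hom(V, W), b = (c \o a)%VF.
Proof.
move=> ab; exists (b \o a^-1)%VF; apply/lfunP => v; rewrite !comp_lfunE.
apply/eqP; rewrite -subr_eq0 -linearB; apply/eqP/ab.
by rewrite linearB /= limg_lfunVK ?subrr // memv_img ?memvf.
Qed.

Lemma lfun_lift (K : fieldType) (U V W : vectType K) (a : 'Hom(U, V))
    (b : 'Hom(W, V)) : (forall w, exists u, b w = a u) ->
  exists c : 'Hom(W, U), b = (a \o c)%VF.
Proof.
move=> ab; exists (a^-1 \o b)%VF; apply/lfunP => v; rewrite !comp_lfunE.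
by have [u ->] := ab v; rewrite limg_lfunVK // memv_img ?memvf.
Qed.

Section Transfers.
Variables (R : realType) (K : fieldType) (delta : R) (M N : pmod R K) (f : Mor M N).
Hypothesis delta_ge0 : 0 <= delta.
Variables BM Bim BN : set (itvl R * nat).
Hypotheses (hBM : is_barcode_of M BM) (hBN : is_barcode_of N BN).
Hypothesis hBim : is_barcode_of (image_module f) Bim.

Lemma pmap_comp (P : pmod R K) s t u (h1 : s <= t) (h2 : t <= u) (h3 : s <= u) :
  Defs.pmap P h3 = (Defs.pmap P h2 \o Defs.pmap P h1)%VF.
Proof. exact: (fmap_comp P h1 h2 h3). Qed.

Lemma plinC s t (h : s <= t) :
  (plin f t \o Defs.pmap M h)%VF = (Defs.pmap N h \o plin f s)%VF.
Proof. exact: (ntmapP f h). Qed.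

(** What triviality of the kernel, and next of the cokernel, means for vectors, with no choice of a
    kernel object. *)
Definition ker_trivial : Prop := forall t (h : t <= t + delta) v,
  plin f t v = 0 -> Defs.pmap M h v = 0.
Definition coker_trivial : Prop := forall t (h : t <= t + delta) v,
  exists u, Defs.pmap N h v = plin f (t + delta) u.

Let below_transfer := @ith_element_rank_transfer R (below R).
Let above_transfer := @ith_element_rank_transfer R (above R).

(** Ranks of the image into [t] are those of [M] followed by [plin f t], which is the [a] of the
    Frobenius inequality. *)
Lemma im_epi_ith I i t (y : itvl R * nat) :
  ith_element (class_of (@coincide_below R) Bim I) i y -> y.1 t ->
  exists x, ith_element (class_of (@coincide_below R) BM I) i x /\ x.1 t.
Proof.
move=> yi yt; have [L [BL rL _]] := barcode_rank t hBim.
have [L' [BL' rL' _]] := barcode_rank t hBM.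
apply: (below_transfer BL BL' (lexx t) (lexx t) yt yt _ _ yi).
  move=> s st; rewrite -(rL s st) -(rL' s st) lrank_image_module.
  exact: lrank_compl.
move=> s' s s's st; have s't := le_trans s's st.
rewrite -(rL s st) -(rL' s st) -(rL s' s't) -(rL' s' s't).
rewrite !lrank_image_module (pmap_comp M s's st s't).
exact: lrank_frobenius.
Qed.

Lemma epi_im_ith I i t (x : itvl R * nat) : ker_trivial ->
  ith_element (class_of (@coincide_below R) BM I) i x -> x.1 t -> x.1 (t + delta) ->
  exists y, ith_element (class_of (@coincide_below R) Bim I) i y /\ y.1 t.
Proof.
move=> kt xi xt xtd; have td : t <= t + delta by rewrite lerDl.
have [L [BL rL _]] := barcode_rank (t + delta) hBM.
have [L' [BL' rL' _]] := barcode_rank t hBim.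
(* The map of [M] from [t] to [t + delta] is [g \o plin f t]; here [g] is the [a] of the Frobenius
   inequality. *)
have [g gE] := lfun_factor (kt t td).
apply: (below_transfer BL BL' td (lexx t) xtd xt _ _ xi).
  move=> s st; have std := le_trans st td.
  rewrite -(rL s std) -(rL' s st) lrank_image_module.
  by rewrite (pmap_comp M st td std) gE -comp_lfunA; apply: lrank_compl.
move=> s' s s's st; have s't := le_trans s's st.
have std := le_trans st td; have s'td := le_trans s't td.
rewrite -(rL s std) -(rL' s st) -(rL s' s'td) -(rL' s' s't).
rewrite !lrank_image_module (pmap_comp M st td std) (pmap_comp M s't td s'td) gE.
rewrite (pmap_comp M s's st s't) -!comp_lfunA.
have := lrank_frobenius g (plin f t \o Defs.pmap M st)%VF (Defs.pmap M s's).
by rewrite -!comp_lfunA.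
Qed.

Lemma im_mono_ith I i t (y : itvl R * nat) :
  ith_element (class_of (@coincide_above R) Bim I) i y -> y.1 t ->
  exists z, ith_element (class_of (@coincide_above R) BN I) i z /\ z.1 t.
Proof.
move=> yi yt; have [L [BL _ rL]] := barcode_rank t hBim.
have [L' [BL' _ rL']] := barcode_rank t hBN.
apply: (above_transfer BL BL' (lexx t) (lexx t) yt yt _ _ yi).
  move=> s st; rewrite -(rL s st) -(rL' s st) lrank_image_module plinC.
  exact: lrank_compr.
(* The order is reversed: [s'] lies to the right of [s], and the ranks are those of maps out of
   [t]. *)
move=> s' s s's st; have s't : t <= s' := le_trans st s's.
rewrite -(rL s st) -(rL' s st) -(rL s' s't) -(rL' s' s't).
rewrite !lrank_image_module !plinC (pmap_comp N st s's s't) -comp_lfunA.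
by have := lrank_frobenius (Defs.pmap N s's) (Defs.pmap N st) (plin f t); rewrite addnC.
Qed.

Lemma mono_im_ith I i t (z : itvl R * nat) : coker_trivial ->
  ith_element (class_of (@coincide_above R) BN I) i z -> z.1 t -> z.1 (t + delta) ->
  exists y, ith_element (class_of (@coincide_above R) Bim I) i y /\ y.1 (t + delta).
Proof.
move=> ct zi zt ztd; have td : t <= t + delta by rewrite lerDl.
have [L [BL _ rL]] := barcode_rank t hBN.
have [L' [BL' _ rL']] := barcode_rank (t + delta) hBim.
(* Dually, the map of [N] from [t] to [t + delta] is [plin f (t + delta) \o g]; here [g] is the [c]
   of the Frobenius inequality. *)
have [g gE] := lfun_lift (ct t td).
apply: (above_transfer BL BL' td (lexx _) zt ztd _ _ zi).
  move=> s st; have std := le_trans td st.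
  rewrite -(rL s std) -(rL' s st) lrank_image_module plinC.
  by rewrite (pmap_comp N td st std) gE comp_lfunA; apply: lrank_compr.
move=> s' s s's st; have s't : t + delta <= s' := le_trans st s's.
have std := le_trans td st; have s'td := le_trans td s't.
rewrite -(rL s std) -(rL' s st) -(rL s' s'td) -(rL' s' s't).
rewrite !lrank_image_module !plinC.
rewrite (pmap_comp N td st std) (pmap_comp N td s't s'td) gE (pmap_comp N st s's s't).
have := lrank_frobenius (Defs.pmap N s's) (Defs.pmap N st \o plin f (t + delta))%VF g.
by rewrite -!comp_lfunA addnC.
Qed.

End Transfers.

(** * Kernels and cokernels *)

Lemma zero_object_hom_unique (A : category) (Z X : A) (u v : Mor Z X) :
  zero_object Z -> u = v.
Proof. by move=> [_ /(_ X)[w wP]]; rewrite (wP u) (wP v). Qed.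

Section VectZero.
Variables (R : realType) (K : fieldType).

Lemma vect_zero_morphism (U V : vect K) (g : Mor U V) :
  zero_morphism g -> g = 0 :> 'Hom(U, V).
Proof.
move=> [Z [a [b [Z0 ->]]]].
rewrite (zero_object_hom_unique b (0 : 'Hom(Z, V)) Z0).
by apply/lfunP => v; rewrite [LHS]comp_lfunE !lfunE.
Qed.

Definition zero_pmod : pmod R K.
Proof.
refine (@RFunctor R (vect K) (fun _ => 'rV[K]_0 : vectType K) (fun _ _ _ => \1%VF) _ _).
- by [].
- by move=> *; rewrite /= comp_lfun1l.
Defined.

Definition zero_nattrans (M N : pmod R K) : Mor M N.
Proof.
exists (fun t => 0 : 'Hom(pspace M t, pspace N t)) => s t h.
by apply/lfunP => v; rewrite [LHS]comp_lfunE [RHS]comp_lfunE !lfunE /= linear0.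
Defined.

Lemma zero_pmodP : zero_object zero_pmod.
Proof.
split=> X; exists (zero_nattrans _ _) => g;
  apply: nattrans_eq => t; apply/lfunP => v /=.
  by rewrite [RHS]lfunE; apply: (thinmx0 (ntmap g t v : 'rV[K]_0)).
by rewrite [v](thinmx0 (v : 'rV[K]_0)) !linear0.
Qed.

Lemma pmod_zero_morphism (M N : pmod R K) (g : Mor M N) :
  (forall t v, plin g t v = 0) -> zero_morphism g.
Proof.
move=> g0; exists zero_pmod, (zero_nattrans _ _), (zero_nattrans _ _); split.
  exact: zero_pmodP.
apply: nattrans_eq => t; apply/lfunP => v.
by rewrite [LHS]g0 /= comp_lfunE !lfunE.
Qed.

End VectZero.

(** * Pointwise kernels and cokernels of persistence modules *)

Section KernelCokernel.
Variables (R : realType) (K : fieldType) (M N : pmod R K) (f : Mor M N).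

Let kspace t : {vspace pspace M t} := lker (plin f t).

Let kmap s t (h : s <= t) : 'Hom(subvs_of (kspace s), subvs_of (kspace t)) :=
  linfun (vsproj (kspace t) \o (Defs.pmap M h \o @vsval _ _ (kspace s))).

Lemma kmapE s t (h : s <= t) u : vsval (kmap h u) = Defs.pmap M h (vsval u).
Proof.
rewrite lfunE /= vsprojK // memv_ker; have /lfunP/(_ (vsval u)) := plinC f h.
rewrite !comp_lfunE => ->.
by have := subvsP u; rewrite memv_ker => /eqP ->; rewrite linear0.
Qed.

(** A test object for the universal property of an arbitrary kernel of [f]. *)
Definition kernel_module : pmod R K.
Proof.
refine (@RFunctor R (vect K) (fun t => subvs_of (kspace t)) kmap _ _).
- move=> t h; apply/lfunP => u; apply: val_inj.
  by rewrite /= kmapE id_lfunE /Defs.pmap fmap_id /= id_lfunE.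
- move=> s t u h1 h2 h3; apply/lfunP => v; apply: val_inj.
  by rewrite /= comp_lfunE !kmapE (pmap_comp M h1 h2 h3) comp_lfunE.
Defined.

Definition kernel_incl : Mor kernel_module M.
Proof.
exists (fun t => linfun (@vsval _ _ (kspace t))) => s t h.
apply/lfunP => u; rewrite [LHS]comp_lfunE [RHS]comp_lfunE.
rewrite [LHS]lfunE [X in _ = _ X]lfunE.
exact: kmapE.
Defined.

(* The quotient of [N t] by the image of [f] is modelled by a complement of that
   image, the range of the projection [coproj t]. *)
Let coproj t : 'Hom(pspace N t, pspace N t) := (\1 - projv (im_space f t))%VF.

Let coproj_eq0 t v : (coproj t v == 0) = (v \in im_space f t).
Proof.
rewrite /coproj add_lfunE opp_lfunE id_lfunE subr_eq0.
apply/eqP/idP => [e|/projv_id ->//].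
by rewrite e memv_proj.
Qed.

Let coproj_sub t v : v - coproj t v \in im_space f t.
Proof. by rewrite /coproj add_lfunE opp_lfunE id_lfunE subKr memv_proj. Qed.

Let coproj_pmap s t (h : s <= t) v :
  coproj t (Defs.pmap N h (coproj s v)) = coproj t (Defs.pmap N h v).
Proof.
apply/esym/eqP; rewrite -subr_eq0 -!linearB /= coproj_eq0.
have /memv_imgP[w _ ->] := coproj_sub v.
have /lfunP/(_ w) := plinC f h; rewrite !comp_lfunE => <-.
by apply: memv_img; apply: memvf.
Qed.

Let cspace t : {vspace pspace N t} := limg (coproj t).

Let cmap s t (h : s <= t) : 'Hom(subvs_of (cspace s), subvs_of (cspace t)) :=
  linfun (vsproj (cspace t) \o (coproj t \o (Defs.pmap N h \o @vsval _ _ (cspace s)))).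

Let cmapE s t (h : s <= t) u :
  vsval (cmap h u) = coproj t (Defs.pmap N h (vsval u)).
Proof. by rewrite lfunE /= vsprojK // memv_img ?memvf. Qed.

Let coproj_id t (u : subvs_of (cspace t)) : coproj t (vsval u) = vsval u.
Proof.
have /memv_imgP[w _ ->] := subvsP u.
by apply/eqP; rewrite -subr_eq0 -linearB /= coproj_eq0 -opprB rpredN coproj_sub.
Qed.

Definition cokernel_module : pmod R K.
Proof.
refine (@RFunctor R (vect K) (fun t => subvs_of (cspace t)) cmap _ _).
- move=> t h; apply/lfunP => u; apply: val_inj.
  by rewrite /= cmapE id_lfunE /Defs.pmap fmap_id /= id_lfunE coproj_id.
- move=> s t u h1 h2 h3; apply/lfunP => v; apply: val_inj.
  by rewrite /= comp_lfunE !cmapE coproj_pmap (pmap_comp N h1 h2 h3) comp_lfunE.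
Defined.

Definition cokernel_proj : Mor N cokernel_module.
Proof.
exists (fun t => linfun (vsproj (cspace t) \o coproj t)) => s t h.
apply/lfunP => u; apply: val_inj; rewrite [LHS]/= [RHS]/= !comp_lfunE cmapE.
rewrite !lfunE /= !vsprojK ?memv_img ?memvf // -[RHS]add_lfunE.
by rewrite -/(coproj t) coproj_pmap.
Defined.

(** The inclusion of the pointwise kernel factors through the given kernel [L], so [v] comes from
    [L t], where the internal map over [delta] is zero. *)
Lemma ker_trivial_of_kernel (delta : R) :
  has_kernel_with (pmod_delta_trivial delta) f -> ker_trivial delta f.
Proof.
move=> [L [k [[_ k_univ] Ltriv]]] t h v fv0.
have [|g [gk _]] := k_univ _ kernel_incl.
  apply: pmod_zero_morphism => s u; rewrite /plin /= comp_lfunE lfunE /=.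
  by have := subvsP u; rewrite memv_ker => /eqP.
have vk : v \in kspace t by rewrite memv_ker fv0.
pose x : pspace kernel_module t := vsproj (kspace t) v.
have vE : v = plin k t (plin g t x).
  have := congr1 (fun g' : Mor kernel_module M => plin g' t x) gk.
  by rewrite /plin /= comp_lfunE lfunE /= vsprojK.
rewrite vE; set w := plin g t _.
have /lfunP/(_ w) := plinC k h; rewrite !comp_lfunE => <-.
have := vect_zero_morphism (Ltriv t h); rewrite /Defs.pmap => ->.
by rewrite lfunE /= linear0.
Qed.

(** The projection to the pointwise cokernel factors through the given [C], whose internal map over
    [delta] is zero; hence it kills [pmap N h v]. *)
Lemma coker_trivial_of_cokernel (delta : R) :
  has_cokernel_with (pmod_delta_trivial delta) f -> coker_trivial delta f.
Proof.
move=> [C [c [[_ c_univ] Ctriv]]] t h v.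
have [|g [gc _]] := c_univ _ cokernel_proj.
  apply: pmod_zero_morphism => s u; apply: val_inj.
  rewrite /plin /= comp_lfunE lfunE /= vsprojK ?memv_img ?memvf //.
  by apply/eqP; rewrite coproj_eq0 memv_img ?memvf.
suff : Defs.pmap N h v \in im_space f (t + delta) by case/memv_imgP => u _ ->; exists u.
rewrite -coproj_eq0; apply/eqP.
have := congr1 (fun g' : Mor N cokernel_module =>
  vsval (plin g' (t + delta) (Defs.pmap N h v) : subvs_of (cspace (t + delta)))) gc.
rewrite /plin /= comp_lfunE [X in _ = vsval X]lfunE /=.
rewrite vsprojK ?memv_img ?memvf // => <-.
have /lfunP/(_ v) := plinC c h; rewrite !comp_lfunE /plin => ->.
have := vect_zero_morphism (Ctriv t h); rewrite /Defs.pmap => ->.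
by rewrite lfunE /= linear0.
Qed.

End KernelCokernel.

(** * Removing overlapped intervals from an interval *)

Section Trimming.
Variable R : realType.
Variable le : side R.

Let le_refl := side_refl le.
Let le_tran := @side_tran R le.
Let le_tot := side_tot le.
Let itvl_conv := @side_conv R le.

(* [overlaps (below R) I J] is [overlaps_above I J], whereas
   [overlaps (above R) I J] is [overlaps_above J I]. *)
Definition overlaps (I J : itvl R) : Prop :=
  [/\ exists t, I t /\ J t, bounds (flip le) I J & bounds le J I].

Variables (A : Type) (Y : A -> Prop) (J : A -> itvl R) (I : itvl R).
Hypothesis IJ : forall y, Y y -> overlaps I (J y).

(** In its use, [Y] holds the partners of [I] under a matching, at most one; a predicate covers
    matched and unmatched intervals alike. *)
Definition trimmed (t : R) : Prop := I t /\ forall y, Y y -> ~ J y t.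

(** Each [J y] reaches back at least as far as [I], so only an initial part of [I] is removed. *)
Lemma trimmed_conv a b c : trimmed a -> trimmed c -> le a b -> le b c -> trimmed b.
Proof.
move=> [Ia nJa] [Ic nJc] ab bc; split=> [|y Yy Jb]; first exact: itvl_conv Ia Ic ab bc.
have [_ _ /(_ a Ia)[e [Je ea]]] := IJ Yy.
by apply: (nJa y Yy); apply: itvl_conv Je Jb ea ab.
Qed.

Lemma overlaps_trimmed_self (D : itvl R) : (forall t, D t <-> trimmed t) ->
  overlaps D I.
Proof.
move=> DE; have [r Dr] := iset_nonempty D; have [Ir nJr] := (DE r).1 Dr.
split; first by exists r.
  move=> s Is; have [Ds|] := pselect (D s).
    by exists s; split=> //; apply: le_refl.
  rewrite DE => /not_andP[//|/existsNP[y /not_implyP[Yy /contrapT Js]]].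
  exists r; split=> //; have [//|rs] := le_tot s r; case: (nJr y Yy).
  have [_ _ /(_ r Ir)[e [Je er]]] := IJ Yy.
  exact: itvl_conv Je Js er rs.
by move=> t /DE[It _]; exists t; split=> //; apply: le_refl.
Qed.

Lemma overlaps_trimmed_trans (T D : itvl R) : (forall t, D t <-> trimmed t) ->
  overlaps T D -> overlaps T I.
Proof.
move=> DE [[t [Tt /DE[It _]]] TD DT]; have [_ DI ID] := overlaps_trimmed_self DE.
split; [by exists t|exact: bounds_trans TD DI|exact: bounds_trans ID DT].
Qed.

Section Factor.
Variable T : itvl R.
Hypothesis TI : overlaps T I.
Hypothesis TJ : forall y, Y y -> ~ overlaps T (J y).

(** The bounds of [T] by [I] and of [I] by [J y] compose; an overlap can fail only through an empty
    intersection. *)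
Lemma not_overlaps_disjoint y t : Y y -> T t -> ~ J y t.
Proof.
move=> Yy Tt Jt; apply: (TJ Yy); have [_ TI1 TI2] := TI; have [_ IJ1 IJ2] := IJ Yy.
split; [by exists t|exact: bounds_trans TI1 IJ1|exact: bounds_trans IJ2 TI2].
Qed.

Lemma trimmed_meet : exists r, T r /\ trimmed r.
Proof.
have [[r [Tr Ir]] _ _] := TI; exists r; split=> //; split=> // y Yy.
exact: not_overlaps_disjoint.
Qed.

Lemma overlaps_trimmed (D : itvl R) : (forall t, D t <-> trimmed t) -> overlaps T D.
Proof.
move=> DE; have [r [Tr [Ir nJr]]] := trimmed_meet; have [_ TI1 TI2] := TI.
split; first by exists r; split=> //; apply/DE.
  by move=> s /DE[/TI1].
move=> t Tt; have [It|nIt] := pselect (I t).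
  exists t; split; last exact: le_refl.
  by apply/DE; split=> // y Yy; apply: not_overlaps_disjoint.
exists r; split; first exact/DE.
have [//|tr] := le_tot r t; have [e [Ie et]] := TI2 _ Tt.
by case: nIt; apply: itvl_conv Ie Ir et tr.
Qed.

End Factor.

End Trimming.

(** * Kernels and cokernels of overlap matchings *)

Section BarcKernel.
Variable R : realType.
Implicit Types C D : barcode R.

Let overlaps_belowE (I J : itvl R) : overlaps_above I J <-> overlaps (below R) I J.
Proof. by []. Qed.

Let overlaps_aboveE (I J : itvl R) : overlaps_above J I <-> overlaps (above R) I J.
Proof. by split=> -[[t [? ?]] ? ?]; split=> //; exists t. Qed.

Definition empty_matching (S T : Type) : matching S T.
Proof. by exists (fun _ _ => False). Defined.

Lemma mch_zero_morphism (S T : Mch) (g : matching S T) :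
  (forall x y, ~ g x y) -> @zero_morphism Mch S T g.
Proof.
move=> g0; exists (False : Type), (empty_matching S False), (empty_matching False T).
split; last by apply: matching_eq => x y; split=> [/g0|[]].
by split=> X; exists (empty_matching _ _) => h; apply: matching_eq => x y; split.
Qed.

Definition empty_overlap C D : overlap_matching C D.
Proof. by exists (empty_matching _ _). Defined.

Definition empty_barcode : barcode R := Barcode (set0 : set (itvl R * False)).

(** A morphism out of a zero object equals the empty one, so whatever factors through it is
    empty. *)
Lemma barc_zero_morphismP C D (g : overlap_matching C D) :
  @zero_morphism (Barc R) C D g <-> forall x y, ~ g x y.
Proof.
split=> [[Z [a [b [Z0 ->]]]] x y [[z [_ zy]] _]|g0].
  pose e : @Mor (Barc R) Z D := empty_overlap Z D.
  by rewrite (zero_object_hom_unique b e Z0) in zy.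
exists empty_barcode, (empty_overlap _ _), (empty_overlap _ _); split; last first.
  by apply: overlap_matching_eq => x y; split=> [/g0[]|[[z [[]]]]].
split=> X; exists (empty_overlap _ _) => h; apply: overlap_matching_eq.
  by move=> x [[_ []]].
by move=> [[_ []]].
Qed.

Section TrimmedBarcode.
Variables (E : barcode R) (A : Type) (Y : belt E -> A -> Prop) (J : A -> itvl R).

(** The elements of [E] serve as indices. Those trimmed to the empty set drop out by themselves, as
    an [itvl] is nonempty. *)
Definition trimmed_barcode : barcode R :=
  Barcode [set p : itvl R * belt E |
    forall t, p.1 t <-> trimmed (Y p.2) J (bitv p.2) t].

Definition untrimmed (p : belt trimmed_barcode) : belt E := (sval p).2.

Lemma trimmed_barcodeP p t :
  bitv p t <-> trimmed (Y (untrimmed p)) J (bitv (untrimmed p)) t.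
Proof. exact: (set_mem (valP p)). Qed.

Lemma untrimmed_inj p q : untrimmed p = untrimmed q -> p = q.
Proof.
rewrite /untrimmed => pq; apply: val_inj.
move: (@trimmed_barcodeP p) (@trimmed_barcodeP q).
case: p q pq => [[I x] pI] [[I' y] qI] /= xy.
rewrite /bitv /untrimmed /= => IE I'E; subst y; congr pair; apply: itvl_ext => t.
exact: iff_trans (IE t) (iff_sym (I'E t)).
Qed.

Lemma untrimmed_exists x r :
  (forall a b c, trimmed (Y x) J (bitv x) a -> trimmed (Y x) J (bitv x) c ->
    a <= b -> b <= c -> trimmed (Y x) J (bitv x) b) ->
  trimmed (Y x) J (bitv x) r -> exists p, untrimmed p = x.
Proof.
move=> conv rP.
pose I := Itvl (ex_intro _ r rP)
  (fun a b c ha hc ab bc => conv a b c ha hc (ltW ab) (ltW bc)).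
have pI : (I, x) \in @bset R trimmed_barcode by apply: mem_set.
by exists (exist _ (I, x) pI).
Qed.

Lemma trimmed_barcode_delta_trivial (delta : R) :
  (forall x t, bitv x t -> bitv x (t + delta) ->
    exists2 y, Y x y & J y t \/ J y (t + delta)) ->
  barcode_delta_trivial delta trimmed_barcode.
Proof.
move=> YP t h; apply: mch_zero_morphism => -[p pt] [q qt] /= pq; subst q.
have [xt nJ] := (trimmed_barcodeP p t).1 pt.
have [xtd nJd] := (trimmed_barcodeP p _).1 qt.
by have [y Yy [yt|ytd]] := YP _ _ xt xtd; [apply: (nJ y Yy yt)|apply: (nJd y Yy ytd)].
Qed.

End TrimmedBarcode.

Section KernelCokernel.
Variables (C D : barcode R) (X : overlap_matching C D).

Definition ker_barcode : barcode R := trimmed_barcode (fun x y => X x y) (@bitv R D).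
Definition coker_barcode : barcode R :=
  trimmed_barcode (fun y x => X x y) (@bitv R C).

Let X_below x y : X x y -> overlaps (below R) (bitv x) (bitv y).
Proof. by move=> /omatchP. Qed.

Let X_above y x : X x y -> overlaps (above R) (bitv y) (bitv x).
Proof. by move=> /omatchP/overlaps_aboveE. Qed.

Definition ker_matching : overlap_matching ker_barcode C.
Proof.
unshelve eexists.
  exists (fun p x => untrimmed p = x) => [p x y <- //|p q x <- /esym].
  exact: untrimmed_inj.
move=> p x /= <-; apply/overlaps_belowE.
exact: (overlaps_trimmed_self (@X_below _) (trimmed_barcodeP p)).
Defined.

(** If [g] composes with [X] to zero and matches [u] with [x], then [u] is disjoint from the partner
    of [x]; so it overlaps the trimmed [x], which is nonempty, and [g] factors. *)
Lemma ker_matchingP : @is_kernel (Barc R) C D X ker_barcode ker_matching.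
Proof.
split; first apply/barc_zero_morphismP =>
    p y [[x [/= <- Xy]] [[t [/trimmed_barcodeP[_ nt] yt]] _ _]].
  exact: nt Xy yt.
move=> T g /barc_zero_morphismP Xg.
(* A zero composite may still relate [u] to [y] as a relation; only the overlap is excluded. *)
have gX u x : g u x -> forall y, X x y -> ~ overlaps (below R) (bitv u) (bitv y).
  by move=> gx y Xy uy; apply: (Xg u y); split=> //; exists x.
have g_overlaps u x : g u x -> overlaps (below R) (bitv u) (bitv x) by move=> /omatchP.
have @h : matching (belt T) (belt ker_barcode).
  exists (fun u p => g u (untrimmed p)) => [u p q gp gq|u v p gu gv].
    exact/untrimmed_inj/(mrel_fun gp gq).
  exact: mrel_inj gu gv.
have hP u p : h u p -> overlaps_above (bitv u) (bitv p).
  move=> gp; exact: (overlaps_trimmed (@X_below _) (g_overlaps _ _ gp) (gX _ _ gp)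
    (trimmed_barcodeP p)).
exists (OverlapMatching hP); split.
  apply: overlap_matching_eq => u x; split=> [[[p [/= gp <-]] _] //|gx].
  have [r [_ rx]] := trimmed_meet (@X_below _) (g_overlaps _ _ gx) (gX _ _ gx).
  have [p px] := untrimmed_exists (trimmed_conv (@X_below x)) rx.
  by split; [exists p => /=; rewrite px|exact: g_overlaps].
move=> h' h'g; apply: overlap_matching_eq => u p; split=> [/=|h'p].
  by rewrite -h'g => -[[q [h'q /untrimmed_inj <-]] _].
rewrite /= -h'g; split; first by exists p.
exact: (overlaps_trimmed_trans (@X_below _) (trimmed_barcodeP p) (omatchP h'p)).
Qed.

Definition coker_matching : overlap_matching D coker_barcode.
Proof.
unshelve eexists.
  exists (fun y p => untrimmed p = y) => [y p q <- /esym|x y p <- <- //].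
  exact: untrimmed_inj.
move=> y p /= <-; apply/overlaps_aboveE.
exact: (overlaps_trimmed_self (@X_above _) (trimmed_barcodeP p)).
Defined.

Lemma coker_matchingP : @is_cokernel (Barc R) C D X coker_barcode coker_matching.
Proof.
split; first apply/barc_zero_morphismP =>
    x p [[y [Xy /= py]] [[t [xt /trimmed_barcodeP[_ nt]]] _ _]].
  by apply: nt xt; rewrite py.
move=> T g /barc_zero_morphismP gX0.
have gX y u : g y u -> forall x, X x y -> ~ overlaps (above R) (bitv u) (bitv x).
  by move=> gy x Xy ux; apply: (gX0 x u); split; [exists y|apply/overlaps_aboveE].
have g_overlaps y u : g y u -> overlaps (above R) (bitv u) (bitv y).
  by move=> /omatchP/overlaps_aboveE.
have @h : matching (belt coker_barcode) (belt T).
  exists (fun p u => g (untrimmed p) u) => [p u v gu gv|p q u gp gq].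
    exact: mrel_fun gu gv.
  exact/untrimmed_inj/(mrel_inj gp gq).
have hP p u : h p u -> overlaps_above (bitv p) (bitv u).
  move=> gp; apply/overlaps_aboveE.
  exact: (overlaps_trimmed (@X_above _) (g_overlaps _ _ gp) (gX _ _ gp)
    (trimmed_barcodeP p)).
exists (OverlapMatching hP); split.
  apply: overlap_matching_eq => y u; split=> [[[p [/= <- gp]] _] //|gy].
  have [r [_ ry]] := trimmed_meet (@X_above _) (g_overlaps _ _ gy) (gX _ _ gy).
  have [p py] : exists p : belt coker_barcode, untrimmed p = y.
    (* Convexity is available for the reversed order, whence the exchange of [a] and [c]. *)
    apply: untrimmed_exists ry => a b c Ta Tc ab bc.
    exact: (trimmed_conv (@X_above y) Tc Ta bc ab).
  by split; [exists p => /=; rewrite py|exact: omatchP gy].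
move=> h' h'g; apply: overlap_matching_eq => p u; split=> [/=|h'p].
  by rewrite -h'g => -[[q [/untrimmed_inj -> h'q]] _].
rewrite /= -h'g; split; first by exists p.
apply/overlaps_aboveE.
apply: (overlaps_trimmed_trans (@X_above _) (trimmed_barcodeP p)).
exact/overlaps_aboveE/omatchP/h'p.
Qed.

End KernelCokernel.

End BarcKernel.

(** * The induced matching *)

Section ClassMatching.
Variable R : realType.
Variable le : side R.

(** Two intervals of one class are nested, hence share a point at which their positions can be
    compared. *)
Lemma ith_element_unique (B : set (itvl R * nat)) I i x y :
  (forall t, exists L, bars_at B t L) ->
  ith_element (class_of (coincide le) B I) i x ->
  ith_element (class_of (coincide le) B I) i y -> x = y.
Proof.
move=> Bfin xi yi; have [[[_ xI] _] [[_ yI] _]] := (xi, yi).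
have [t [xt yt]] : exists t, x.1 t /\ y.1 t.
  have [xy|yx] := coincide_nested (coincide_trans xI (coincide_sym yI)).
    by have [t xt] := iset_nonempty x.1; exists t; split; last exact: xy.
  by have [t yt] := iset_nonempty y.1; exists t; split; first exact: yx.
by have [L BL] := Bfin t; apply: (ith_element_inj BL xt yt xi yi).
Qed.

Lemma match_by_class_fun (C D : set (itvl R * nat)) x y y' :
  (forall t, exists L, bars_at D t L) ->
  match_by_class (coincide le) C D x y ->
  match_by_class (coincide le) C D x y' -> y = y'.
Proof.
move=> Dfin [I [i [[[_ xI] xi] yi]]] [I' [i' [[[_ xI'] xi'] yi']]].
(* The two witnesses may name the class by different representatives; both coincide with [x.1]. *)
have classE B : class_of (coincide le) B I' = class_of (coincide le) B I.
  have II' := coincide_trans (coincide_sym xI) xI'.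
  apply/seteqP; split=> z [Bz zI]; split=> //.
    exact: (coincide_trans zI (coincide_sym II')).
  exact: (coincide_trans zI II').
rewrite !classE in xi' yi'.
have ii' : i = i'.
  by apply/card_eq_II; apply: card_eq_trans xi'; rewrite card_eq_sym.
by subst i'; apply: ith_element_unique yi yi'.
Qed.

Lemma match_by_class_sym (coinc : itvl R -> itvl R -> Prop)
    (C D : set (itvl R * nat)) x y :
  match_by_class coinc C D x y -> match_by_class coinc D C y x.
Proof. by move=> [I [i [xi yi]]]; exists I, i. Qed.

Lemma ith_element_of_mem (B : set (itvl R * nat)) x :
  (forall t, exists L, bars_at B t L) -> B x ->
  exists i, ith_element (class_of (coincide le) B x.1) i x.
Proof.
move=> Bfin Bx; have [t xt] := iset_nonempty x.1; have [L BL] := Bfin t.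
exists (position le x.1 x L); apply: (ith_element_pos BL xt).
by split=> //; apply: coincide_refl.
Qed.

End ClassMatching.

Section Induced.
Variables (R : realType) (K : fieldType) (delta : R) (M N : pmod R K) (f : Mor M N).
Hypothesis delta_ge0 : 0 <= delta.
Variables BM Bim BN : set (itvl R * nat).
Hypotheses (hBM : is_barcode_of M BM) (hBN : is_barcode_of N BN).
Hypothesis hBim : is_barcode_of (image_module f) Bim.

Let BMfin := bars_at_barcode hBM.
Let BNfin := bars_at_barcode hBN.
Let Bimfin := bars_at_barcode hBim.

(** For each [t] in [y.1] some element at the same position in the class contains [t]; by uniqueness
    it is [x]. *)
Lemma epi_matching_sub x y : epi_matching BM Bim x y -> forall t, y.1 t -> x.1 t.
Proof.
move=> [I [i [xi yi]]] t yt; have [x' [xi' xt]] := im_epi_ith hBM hBim yi yt.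
by rewrite (ith_element_unique (le := below R) BMfin xi xi').
Qed.

Lemma mono_matching_sub y z : mono_matching Bim BN y z -> forall t, y.1 t -> z.1 t.
Proof.
move=> [I [i [yi zi]]] t yt; have [z' [zi' zt]] := im_mono_ith hBN hBim yi yt.
by rewrite (ith_element_unique (le := above R) BNfin zi zi').
Qed.

(** The intermediate interval lies in [x.1] with the same lower end, and in [z.1] with the same
    upper end. *)
Lemma induced_matching_overlaps x z :
  induced_matching BM Bim BN x z -> overlaps_above x.1 z.1.
Proof.
move=> [y [xy yz]]; have yx := epi_matching_sub xy; have yz' := mono_matching_sub yz.
have [t yt] := iset_nonempty y.1; split.
- by exists t; split; [apply: yx|apply: yz'].
- have [J [j [[[_ yJ] _] [[_ zJ] _]]]] := yz => s zs.
  have [yz_above _] :=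
    @coincide_trans R (above R) _ _ _ yJ (coincide_sym (le := above R) zJ).
  by have [r [yr sr]] := yz_above s zs; exists r; split=> //; apply: yx.
- have [J [j [[[_ xJ] _] [[_ yJ] _]]]] := xy => s xs.
  have [yx_below _] :=
    @coincide_trans R (below R) _ _ _ yJ (coincide_sym (le := below R) xJ).
  by have [r [yr rs]] := yx_below s xs; exists r; split=> //; apply: yz'.
Qed.

Definition induced_overlap_matching :
  overlap_matching (nat_barcode BM) (nat_barcode BN).
Proof.
unshelve eexists.
  exists (fun x y => induced_matching BM Bim BN (sval x) (sval y)).
  - move=> x z z' [y [xy yz]] [y' [xy' yz']]; apply: val_inj.
    have yy' := match_by_class_fun (le := below R) Bimfin xy xy'.
    subst y'; exact: (match_by_class_fun (le := above R) BNfin yz yz').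
  - move=> x x' z [y [xy yz]] [y' [xy' yz']]; apply: val_inj.
    have yy' := match_by_class_fun (le := above R) Bimfin
      (match_by_class_sym yz) (match_by_class_sym yz').
    subst y'; exact: (match_by_class_fun (le := below R) BMfin
      (match_by_class_sym xy) (match_by_class_sym xy')).
by move=> x z; apply: induced_matching_overlaps.
Defined.

(** Passing through the image keeps [t], so trimming [x] by its partner removes [t]. *)
Lemma induced_matching_ker x t : ker_trivial delta f ->
  BM x -> x.1 t -> x.1 (t + delta) ->
  exists z, [/\ BN z, induced_matching BM Bim BN x z & z.1 t].
Proof.
move=> kt Bx xt xtd; have [i xi] := ith_element_of_mem (below R) BMfin Bx.
have [y [yi yt]] := epi_im_ith delta_ge0 hBM hBim kt xi xt xtd.
have [j yj] := ith_element_of_mem (above R) Bimfin yi.1.1.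
have [z [zj zt]] := im_mono_ith hBN hBim yj yt.
exists z; split=> //; first exact: zj.1.1.
by exists y; split; [exists x.1, i|exists y.1, j].
Qed.

(** Here [t + delta] is kept, so trimming [z] by its partner removes that point. *)
Lemma induced_matching_coker z t : coker_trivial delta f ->
  BN z -> z.1 t -> z.1 (t + delta) ->
  exists x, [/\ BM x, induced_matching BM Bim BN x z & x.1 (t + delta)].
Proof.
move=> ct Bz zt ztd; have [j zj] := ith_element_of_mem (above R) BNfin Bz.
have [y [yj yt]] := mono_im_ith delta_ge0 hBN hBim ct zj zt ztd.
have [i yi] := ith_element_of_mem (below R) Bimfin yj.1.1.
have [x [xi xt]] := im_epi_ith hBM hBim yi yt.
exists x; split=> //; first exact: xi.1.1.
by exists y; split; [exists y.1, i|exists z.1, j].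
Qed.

End Induced.

Theorem theorem1p4 (R : realType) (K : fieldType) (delta : R)
    (delta_ge0 : 0 <= delta)
    (M N : pmod R K) (f : Mor M N)
    (BM Bim BN : set (itvl R * nat))
    (hBM : is_barcode_of M BM)
    (hBim : is_barcode_of (image_module f) Bim)
    (hBN : is_barcode_of N BN) :
  exists X : @Mor (Barc R) (nat_barcode BM) (nat_barcode BN),
    (forall (x : set_type BM) (y : set_type BN),
       omatch X x y <-> induced_matching BM Bim BN (sval x) (sval y)) /\
    (has_kernel_with (pmod_delta_trivial delta) f ->
       has_kernel_with (barcode_delta_trivial delta) X) /\
    (has_cokernel_with (pmod_delta_trivial delta) f ->
       has_cokernel_with (barcode_delta_trivial delta) X).
Proof.
pose X := induced_overlap_matching hBM hBN hBim; exists X; split; [by []|split].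
- move=> /ker_trivial_of_kernel kt.
  exists (ker_barcode X), (ker_matching X); split; first exact: ker_matchingP.
  apply: trimmed_barcode_delta_trivial => x t xt xtd.
  have [z [Bz xz zt]] := induced_matching_ker delta_ge0 hBM hBN hBim kt
    (set_mem (valP x)) xt xtd.
  by exists (SigSub (mem_set Bz)) => //; left.
- move=> /coker_trivial_of_cokernel ct.
  exists (coker_barcode X), (coker_matching X); split; first exact: coker_matchingP.
  apply: trimmed_barcode_delta_trivial => z t zt ztd.
  have [x [Bx xz xt]] := induced_matching_coker delta_ge0 hBM hBN hBim ct
    (set_mem (valP z)) zt ztd.
  by exists (SigSub (mem_set Bx)) => //; right.
Qed.
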